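(* Let $A$ be a commutative $C^*$-algebra with spectrum $\Delta(A)$, let $\sigma : A \to A$ be an automorphism, and let $\Xi$ be the set of non-zero multiplicative linear functionals on $\ell_1^{\widehat{\sigma}}(\mathbb{Z}, C_0(\Delta(A)))$. For any $x \in \mathrm{Per}^1(\Delta(A))$ and $\xi \in \mathbb{T}$ there is a unique element $\mu \in \Xi$ such that $\mu(f_n\delta^n) = f_n(x)\xi^n$ for all $n\in\mathbb{Z}$ and all $f_n\in C_0(\Delta(A))$, and every element of $\Xi$ is of this form for a unique $x\in \mathrm{Per}^1(\Delta(A))$ and a unique $\xi\in\mathbb{T}$. Thus this correspondence is a bijection between $\Xi$ and $\mathrm{Per}^1(\Delta(A)) \times \mathbb{T}$.
   Context: $A$ is not assumed unital; it is identified with $C_0(\Delta(A))$ by the Gelfand transform. The automorphism $\sigma$ induces a homeomorphism $\widetilde{\sigma}:\Delta(A)\to\Delta(A)$, $\widetilde{\sigma}(\mu)=\mu\circ\sigma^{-1}$, and an automorphism $\widehat{\sigma}$ of $C_0(\Delta(A))$, $\widehat{\sigma}(f)=f\circ\widetilde{\sigma}^{-1}$. The Banach algebra $\ell_1^{\widehat{\sigma}}(\mathbb{Z}, C_0(\Delta(A)))$ is the set of formal sums $\sum_{n\in\mathbb{Z}} f_n\delta^n$ with $f_n\in C_0(\Delta(A))$ and $\sum_n\|f_n\|<\infty$, with norm $\sum_n\|f_n\|$, coefficientwise addition and scalar multiplication, and (twisted convolution) multiplication determined by $(f_n\delta^n)*(g_m\delta^m)=f_n\cdot\widehat{\sigma}^n(g_m)\,\delta^{n+m}$.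 $\mathrm{Per}^1(\Delta(A))=\{x\in\Delta(A) : \widetilde{\sigma}(x)=x\}$ and $\mathbb{T}$ is the unit circle in $\mathbb{C}$. *)

(* Defs.v *)
From HB Require Import structures.
From mathcomp Require Import all_boot all_order all_algebra.
From mathcomp Require Import all_classical all_reals all_analysis.
From mathcomp Require Import complex ring lra.

Set Implicit Arguments.
Unset Strict Implicit.
Unset Printing Implicit Defensive.

Import Order.TTheory GRing.Theory Num.Theory.
Import numFieldNormedType.Exports.

Local Open Scope classical_set_scope.
Local Open Scope ring_scope.

(* R[i] on its own is canonically an R-module; wrapping it as a numClosedFieldType
   makes C a normed module over itself. *)
Definition Cplx (R : realType) : numClosedFieldType := R[i].
Arguments Cplx : simpl never.

(* The norm of a C-normed module takes its values in C; [modulus] is the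
   R-valued absolute value, needed for suprema and for sums in \bar R. *)
Definition modulus {R : realType} (z : Cplx R) : R := complex.Re `|z|.
Definition ofR {R : realType} (r : R) : Cplx R := r%:C%C.

Section modulus.
Context {R : realType}.
Implicit Types (z w : Cplx R) (r : R).

Lemma modulusE z : ofR (modulus z) = `|z|.
Proof. by apply: RRe_real; exact: normr_real. Qed.

Lemma ofR_le (r s : R) : (ofR r <= ofR s) = (r <= s).
Proof. exact: lecR. Qed.

Lemma ofR_lt (r s : R) : (ofR r < ofR s) = (r < s).
Proof. exact: ltcR. Qed.

Lemma ofR0 : ofR (0 : R) = 0. Proof. by []. Qed.

Lemma ofRD (r s : R) : ofR (r + s) = ofR r + ofR s.
Proof. exact: (rmorphD (real_complex R)). Qed.

Lemma ofRM (r s : R) : ofR (r * s) = ofR r * ofR s.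
Proof. exact: (rmorphM (real_complex R)). Qed.

Lemma ofR_inj : injective (@ofR R).
Proof. by move=> r s; case. Qed.

Lemma gt0_ofR (e : Cplx R) : 0 < e -> exists2 r : R, 0 < r & e = ofR r.
Proof.
move=> e0; have e_real : (e : R[i]) \is Num.real by exact: gtr0_real.
have eE : e = ofR (complex.Re e) by apply/esym; exact: RRe_real.
by exists (complex.Re e) => //; rewrite -ofR_lt -eE.
Qed.

Lemma modulus_ge0 z : 0 <= modulus z.
Proof. by rewrite -ofR_le modulusE ofR0. Qed.

Lemma modulus0 : modulus (0 : Cplx R) = 0.
Proof. by apply: ofR_inj; rewrite modulusE normr0 ofR0. Qed.

Lemma modulus0_eq z : modulus z = 0 -> z = 0.
Proof. by move=> z0; apply/normr0_eq0; rewrite -modulusE z0 ofR0. Qed.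

Lemma modulusM z w : modulus (z * w) = modulus z * modulus w.
Proof. by apply: ofR_inj; rewrite ofRM !modulusE normrM. Qed.

Lemma modulusV z : modulus z^-1 = (modulus z)^-1.
Proof.
have [->|z0] := eqVneq z 0; first by rewrite invr0 modulus0 invr0.
have m0 : modulus z != 0 by apply: contra z0 => /eqP/modulus0_eq ->.
by apply: (mulIf m0); rewrite -modulusM !mulVf//; apply: ofR_inj;
  rewrite modulusE normr1.
Qed.

Lemma ler_modulusD z w : modulus (z + w) <= modulus z + modulus w.
Proof. by rewrite -ofR_le ofRD !modulusE ler_normD. Qed.

Lemma modulusN z : modulus (- z) = modulus z.
Proof. by apply: ofR_inj; rewrite !modulusE normrN. Qed.

Lemma modulus_dist z w : `|modulus z - modulus w| <= modulus (z - w).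
Proof.
rewrite ler_distl lerBlDr; apply/andP; split.
  rewrite -(modulusN (z - w)) opprB addrC.
  by rewrite -[X in modulus X <= _](subrK z) ler_modulusD.
by rewrite -[X in modulus X <= _](subrK w) addrC ler_modulusD.
Qed.

Lemma modulus_continuous : continuous (@modulus R).
Proof.
move=> z; apply/(@cvgrPdist_lt _ _ _ (nbhs z)) => e e0.
have e0' : 0 < ofR e by rewrite -ofR0 ofR_lt.
have := nbhsx_ballx z _ e0'; apply: filterS => t.
by rewrite -ball_normE/= -modulusE ofR_lt; exact/le_lt_trans/modulus_dist.
Qed.

End modulus.

(* Commutative C*-algebras, not assumed unital. MathComp rings have a unit, so
   the product [amul] is part of the structure. *)
HB.mixin Record NormedModule_isCommCStarAlg (R : realType) A
    of CompleteNormedModule (Cplx R) A := {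
  amul : A -> A -> A ;
  astar : A -> A ;
  amulA : associative amul ;
  amulC : commutative amul ;
  amulDl : left_distributive amul +%R ;
  ascaleAl : forall (c : Cplx R) (a b : A), c *: amul a b = amul (c *: a) b ;
  astarK : involutive astar ;
  astarD : {morph astar : a b / a + b} ;
  astarZ : forall (c : Cplx R) (a : A), astar (c *: a) = (c^*)%R *: astar a ;
  astarM : forall a b, astar (amul a b) = amul (astar b) (astar a) ;
  anormM : forall a b, `|amul a b| <= `|a| * `|b| ;
  anorm_cstar : forall a, `|amul (astar a) a| = `|a| ^+ 2
}.
#[short(type="commCStarAlgType")]
HB.structure Definition CommCStarAlg (R : realType) :=
  {A of CompleteNormedModule (Cplx R) A & NormedModule_isCommCStarAlg R A}.

(* Nonzero multiplicative linear functionals. Continuity is not required: it is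
   automatic on a Banach algebra. *)
Definition is_character (R : realType) (V : lmodType (Cplx R))
    (mul : V -> V -> V) (phi : V -> Cplx R) : Prop :=
  [/\ forall (c : Cplx R) (u v : V), phi (c *: u + v) = c * phi u + phi v,
      forall u v, phi (mul u v) = phi u * phi v
    & exists v, phi v != 0].

Record spectrum (R : realType) (A : commCStarAlgType R) := Spectrum {
  char_fun :> A -> Cplx R ;
  char_funP : is_character (@amul R A) char_fun
}.

HB.instance Definition _ (R : realType) (A : commCStarAlgType R) :=
  gen_eqMixin (spectrum A).
HB.instance Definition _ (R : realType) (A : commCStarAlgType R) :=
  gen_choiceMixin (spectrum A).
(* The Gelfand topology: the coarsest one making all evaluations continuous. *)
HB.instance Definition _ (R : realType) (A : commCStarAlgType R) :=
  Topological.copy (spectrum A)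
    (initial_topology (@char_fun R A : spectrum A -> {ptws A -> Cplx R})).


Section C0.
Context {R : realType} {X : topologicalType}.
Local Notation C := (Cplx R).

Definition c0_set : set (X -> C) := [set f | continuous f /\
  forall e : C, 0 < e ->
    exists2 K : set X, compact K & forall x, ~ K x -> `|f x| < e].

Definition c0_pred : {pred X -> C} := mem c0_set.

Record c0 := C0 { c0_val :> X -> C ; _ : c0_val \in c0_pred }.
HB.instance Definition _ := [isSub for c0_val].
HB.instance Definition _ := [Choice of c0 by <:].

Lemma c0_setP (f : c0) : c0_set f.
Proof. by case: f => f /= /set_mem. Qed.

Lemma c0_submod_closed : submod_closed c0_pred.
Proof.
split=> [|a f g /set_mem[fc fv] /set_mem[gc gv]]; apply/mem_set.
  split=> [x|e e0]; first exact: cvg_cst.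
  by exists set0 => [|x _]; [exact: compact0|rewrite normr0].
split=> [x|e e0].
  exact: (cvgD (cvgZl_tmp (k := a) (fc x)) (gc x)).
have a1 : 0 < `|a| + 1 by rewrite ltr_wpDl.
have [K Kc Kf] := fv (e / 2 / (`|a| + 1)) ltac:(by rewrite !divr_gt0).
have [L Lc Lg] := gv (e / 2) ltac:(by rewrite divr_gt0).
exists (K `|` L) => [|x /not_orP[/Kf fx /Lg gx]]; first exact: compactU.
rewrite (le_lt_trans (ler_normD _ _))// [ltRHS]splitr ltrD//.
rewrite [ltLHS](_ : _ = `|a| * `|f x|); last exact: normrM.
rewrite (le_lt_trans _ (_ : `|f x| * (`|a| + 1) < _))//.
  by rewrite mulrC ler_wpM2l// lerDl.
by rewrite -ltr_pdivlMr.
Qed.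

HB.instance Definition _ := GRing.isSubmodClosed.Build _ _
  c0_pred c0_submod_closed.
HB.instance Definition _ := [SubChoice_isSubLmodule of c0 by <:].

Definition c0norm (f : c0) : R := sup (range (fun x => modulus (f x))).

Lemma c0_bounded (f : c0) : exists M, forall x, modulus (f x) <= M.
Proof.
have [fc /(_ 1 ltr01)[K Kc Kf]] := c0_setP f.
have mfc : continuous (modulus \o f).
  by move=> x; apply: continuous_comp; [exact: fc|exact: modulus_continuous].
have /compact_bounded[M [_ /(_ (M + 1))]] : compact ((modulus \o f) @` K).
  by apply: continuous_compact => //; exact: continuous_subspaceT.
rewrite ltrDl ltr01 => /(_ isT) MK.
exists (Num.max (M + 1) 1) => x; rewrite le_max; apply/orP.
have [Kx|Kx] := pselect (K x); [left|right].
  by apply: le_trans (ler_norm _) _; apply: MK; exists x.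
by move: (Kf x Kx); rewrite -modulusE -[1]/(ofR 1) ofR_lt => /ltW.
Qed.

Lemma c0norm_ub (f : c0) x : modulus (f x) <= c0norm f.
Proof.
by apply: ub_le_sup; [have [M fM] := c0_bounded f; exists M => _ [y _ <-]|exists x].
Qed.

Lemma c0norm_le (f : c0) M : 0 <= M -> (forall x, modulus (f x) <= M) ->
  c0norm f <= M.
Proof.
move=> M0 fM; rewrite /c0norm.
have [[y Sy]|nS] := pselect (range (fun x => modulus (f x)) !=set0).
  by apply: ge_sup; [exists y|move=> _ [x _ <-]].
by rewrite sup_out// => -[].
Qed.

Lemma c0norm_ge0 (f : c0) : 0 <= c0norm f.
Proof.
rewrite /c0norm; have [[x _]|nX] := pselect ([set: X] !=set0).
  exact: le_trans (modulus_ge0 _) (c0norm_ub f x).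
by rewrite sup_out// => -[[_ [x _ _]] _]; apply: nX; exists x.
Qed.

Lemma ler_c0normD (f g : c0) : c0norm (f + g) <= c0norm f + c0norm g.
Proof.
apply: c0norm_le => [|x]; first by rewrite addr_ge0 ?c0norm_ge0.
by rewrite (le_trans (ler_modulusD _ _))// lerD ?c0norm_ub.
Qed.

Lemma c0normZ (a : C) (f : c0) : c0norm (a *: f) = modulus a * c0norm f.
Proof.
have le b g : c0norm (b *: g) <= modulus b * c0norm g.
  apply: c0norm_le => [|x]; first by rewrite mulr_ge0 ?modulus_ge0 ?c0norm_ge0.
  by rewrite [leLHS]modulusM ler_wpM2l ?modulus_ge0 ?c0norm_ub.
apply/eqP; rewrite eq_le le/=; have [->|a0] := eqVneq a 0.
  by rewrite modulus0 mul0r c0norm_ge0.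
have ma : 0 < modulus a.
  by rewrite lt_neqAle modulus_ge0 andbT eq_sym; apply: contra a0 => /eqP/modulus0_eq->.
by rewrite mulrC -ler_pdivlMr// mulrC -modulusV -{1}[f](scalerK a0) le.
Qed.

Lemma c0norm0_eq (f : c0) : c0norm f = 0 -> f = 0.
Proof.
move=> f0; apply/val_inj/funext => x; apply: modulus0_eq.
by apply/eqP; rewrite eq_le modulus_ge0 andbT -f0 c0norm_ub.
Qed.

Let c0_ler_normD (f g : c0) : ofR (c0norm (f + g)) <= ofR (c0norm f) + ofR (c0norm g).
Proof. by rewrite -ofRD ofR_le ler_c0normD. Qed.

Let c0_normrZ (a : C) (f : c0) : ofR (c0norm (a *: f)) = `|a| * ofR (c0norm f).
Proof. by rewrite c0normZ ofRM modulusE. Qed.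

Let c0_normr0_eq0 (f : c0) : ofR (c0norm f) = 0 -> f = 0.
Proof. by move=> f0; apply/c0norm0_eq/ofR_inj. Qed.

HB.instance Definition _ := @Lmodule_isNormed.Build C c0 (fun f => ofR (c0norm f))
  c0_ler_normD c0_normrZ c0_normr0_eq0.

Lemma c0_normE (f : c0) : `|f| = ofR (c0norm f).
Proof. by []. Qed.

End C0.
Arguments c0 : clear implicits.

Lemma seq_dist_lt (K : numFieldType) (V : normedModType K) (u : nat -> V) (l : V) :
  u @ \oo --> l -> forall e : K, 0 < e ->
  exists N : nat, forall n : nat, (N <= n)%N -> `|l - u n| < e.
Proof. by move=> /cvgrPdist_lt ul e /ul[N _ uN]; exists N. Qed.

Section complete.
Context {R : realType}.
Local Notation C := (Cplx R).

Lemma real_seq_cvg (u : nat -> R) :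
    (forall e : R, 0 < e -> exists N : nat,
      forall n : nat, (N <= n)%N -> `|u N - u n| < e) ->
  exists l : R, u @ \oo --> l.
Proof.
move=> uC; apply/cvg_ex; apply: R_complete; apply: cauchy_exP => e e0.
have [N uN] := uC e e0; exists (u N).
by exists N.
Qed.

Lemma Re_modulus (z : C) : `|complex.Re z| <= modulus z.
Proof. by rewrite -ofR_le modulusE; exact: normc_ge_Re. Qed.

Lemma Im_modulus (z : C) : `|complex.Im z| <= modulus z.
Proof.
rewrite -normrN -ReiNIm (le_trans (Re_modulus (z * 'i%C)))// modulusM.
rewrite [X in _ * X](_ : _ = 1) ?mulr1//; apply: ofR_inj.
by rewrite modulusE [LHS]normc_def/= expr0n/= expr1n add0r sqrtr1.
Qed.

Lemma modulus_ReIm (z : C) :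
  modulus z <= `|complex.Re z| + `|complex.Im z|.
Proof.
rewrite -ofR_le modulusE [leLHS]normc_def lecR.
rewrite -(@ler_pXn2r _ 2)// ?nnegrE ?sqrtr_ge0 ?addr_ge0//.
rewrite sqr_sqrtr ?addr_ge0 ?sqr_ge0// sqrrD !real_normK ?num_real//.
by rewrite -addrA [X in _ <= _ + X]addrC addrA lerDl mulrn_wge0 ?mulr_ge0.
Qed.

Lemma Cplx_seq_cvg (z : nat -> C) :
    (forall e : R, 0 < e -> exists N : nat,
      forall n : nat, (N <= n)%N -> modulus (z N - z n) < e) ->
  exists l : C, z @ \oo --> l.
Proof.
move=> zC.
have [a za] : exists l : R, (fun n => complex.Re (z n)) @ \oo --> l.
  apply: real_seq_cvg => e e0; have [N zN] := zC e e0; exists N => n Nn.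
  by apply: le_lt_trans (zN n Nn); rewrite (le_trans _ (Re_modulus _))//= raddfB.
have [b zb] : exists l : R, (fun n => complex.Im (z n)) @ \oo --> l.
  apply: real_seq_cvg => e e0; have [N zN] := zC e e0; exists N => n Nn.
  by apply: le_lt_trans (zN n Nn); rewrite (le_trans _ (Im_modulus _))//= raddfB.
pose l : C := (a +i* b)%C.
exists l; apply/cvgrPdist_lt => _ /gt0_ofR[e e0 ->].
have e2 : 0 < e / 2 by rewrite divr_gt0.
have [M zM] := seq_dist_lt za e2; have [N zN] := seq_dist_lt zb e2.
exists (maxn M N) => // n /=; rewrite geq_max => /andP[Mn Nn].
rewrite -modulusE ofR_lt (le_lt_trans (modulus_ReIm _))//.
rewrite [ltRHS]splitr ltrD//.
  rewrite [X in `|X|](_ : _ = a - complex.Re (z n)); first exact: zM.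
  exact: (raddfB (@complex.Re R)).
rewrite [X in `|X|](_ : _ = b - complex.Im (z n)); first exact: zN.
exact: (raddfB (@complex.Im R)).
Qed.

Context {X : topologicalType}.
Local Notation c0 := (c0 R X).

Lemma c0_uniform_closed (h : X -> C) :
    (forall e : R, 0 < e -> exists p : c0, forall x, modulus (h x - p x) <= e) ->
  c0_set h.
Proof.
move=> hp; split=> [x|_ /gt0_ofR[e e0 ->]].
  apply/(@cvgrPdist_lt _ _ _ (nbhs x)) => _ /gt0_ofR[e e0 ->].
  have e4 : 0 < e / 2 / 2 by rewrite !divr_gt0.
  have [p php] := hp _ e4; have [/(_ x) pc _] := c0_setP p.
  have e2 : 0 < ofR (e / 2) by rewrite -ofR0 ofR_lt divr_gt0.
  move/(@cvgrPdist_lt _ _ _ (nbhs x)) : pc => /(_ _ e2); apply: filterS => t; rewrite -!modulusE !ofR_lt => pxt.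
  have -> : h x - h t = (p x - p t) + ((h x - p x) - (h t - p t)).
    by ring.
  rewrite (le_lt_trans (ler_modulusD _ _))// [ltRHS]splitr ltr_leD//.
  rewrite (le_trans (ler_modulusD _ _))// modulusN [leRHS]splitr lerD//; exact: php.
have e2 : 0 < e / 2 by rewrite divr_gt0.
have [p php] := hp _ e2; have [_ pv] := c0_setP p.
have [K Kc Kp] := pv (ofR (e / 2)) ltac:(by rewrite -ofR0 ofR_lt).
exists K => // x /Kp; rewrite -!modulusE !ofR_lt => px.
rewrite -(subrK (p x) (h x)) (le_lt_trans (ler_modulusD _ _))//.
by rewrite [ltRHS]splitr ler_ltD.
Qed.

Lemma c0_seq_cvg (s : nat -> c0) :
    (forall e : R, 0 < e -> exists N : nat,
      forall n : nat, (N <= n)%N -> c0norm (s N - s n) < e) ->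
  cvgn s.
Proof.
move=> sC.
have s_cvg x : exists l : C, (fun n => s n x : C) @ \oo --> l.
  apply: Cplx_seq_cvg => e e0; have [N sN] := sC e e0; exists N => n /sN.
  by apply: le_lt_trans; exact: (c0norm_ub (s N - s n)).
pose h x := sval (cid (s_cvg x)).
have hE x : (fun n => s n x) @ \oo --> h x := svalP (cid (s_cvg x)).
have h_unif e : 0 < e -> exists N : nat, forall n : nat, (N <= n)%N ->
    forall x, modulus (h x - s n x) <= e.
  move=> e0; have e2 : 0 < e / 2 by rewrite divr_gt0.
  have [N sN] := sC _ e2; exists N => n Nn x; apply/ler_addgt0Pr => d d0.
  have d0' : 0 < ofR d by rewrite -ofR0 ofR_lt.
  have [M hM] := seq_dist_lt (hE x) d0'.
  pose m := maxn M N.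
  have : `|h x - s m x| < ofR d by apply: hM; rewrite /= leq_maxl.
  rewrite -modulusE ofR_lt => hm.
  have -> : h x - s n x = (s N x - s n x) + ((h x - s m x) - (s N x - s m x)).
    by ring.
  rewrite (le_trans (ler_modulusD _ _))//.
  have le1 k : (N <= k)%N -> modulus (s N x - s k x) <= e / 2.
    by move=> /sN/ltW; apply: le_trans; exact: (c0norm_ub (s N - s k)).
  have le2 := ler_modulusD (h x - s m x) (- (s N x - s m x)).
  have le3 := le1 m (leq_maxr _ _); have le4 := le1 n Nn.
  by rewrite modulusN in le2; lra.
have hc0 : h \in c0_pred.
  apply/mem_set/c0_uniform_closed => e e0.
  by have [N hN] := h_unif e e0; exists (s N); exact: hN.
apply/cvg_ex; exists (C0 hc0); apply/cvgrPdist_le => _ /gt0_ofR[e e0 ->].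
have [N hN] := h_unif e e0; exists N => // n /= Nn.
rewrite c0_normE ofR_le; apply: c0norm_le => [|x]; first exact: ltW.
exact: hN.
Qed.

End complete.

(* Two-sided sum over int, as the limit of the partial sums over -N, ..., N-1
   (Negz i is -(i+1)). It is applied only to absolutely convergent families,
   for which the order of summation is irrelevant. *)
Definition bisum (K : numFieldType) (V : normedModType K) (u : int -> V) : V :=
  limn (series (fun i : nat => u (Posz i) + u (Negz i))).

Section summable_int.
Context {R : realType}.
Implicit Types m : int -> R.

Lemma sum_le_esum m N : (forall k, 0 <= m k) ->
  ((\sum_(0 <= i < N) (m (Posz i) + m (Negz i)))%:E <=
     \esum_(k in [set: int]) (m k)%:E)%E.
Proof.
move=> m0; apply: esum_ge.
pose s := [seq Posz i | i <- iota 0 N] ++ [seq Negz i | i <- iota 0 N].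
have us : uniq s.
  rewrite cat_uniq !map_inj_uniq ?iota_uniq/= ?andbT; first last.
  - by move=> i j [].
  - by move=> i j [].
  - by apply/hasPn => _ /mapP[i _ ->]; apply/mapP => -[j _].
exists [set` s]; first by split=> //; exact: finite_seq.
rewrite fsumEFin; last exact: finite_seq.
rewrite -fsbig_seq// lee_fin big_cat/= !big_map big_split/=.
by rewrite /index_iota subn0.
Qed.

Lemma esum_swap (a : int -> int -> \bar R) : (forall i j, 0 <= a i j)%E ->
  \esum_(i in [set: int]) \esum_(j in [set: int]) a i j =
  \esum_(j in [set: int]) \esum_(i in [set: int]) a i j.
Proof.
move=> a0; rewrite (@esum_esum _ _ _ _ (fun=> setT))//.
rewrite (@esum_esum _ _ _ _ (fun=> setT) (fun j i => a i j))//.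
apply: (reindex_esum _ _ (fun p : int * int => (p.2, p.1))).
split=> [[i j]//|[i j] [k l] _ _ [-> ->]//|[i j] _]; by exists (j, i).
Qed.

Lemma le_esumM m (c : R) : (forall k, 0 <= m k) -> 0 <= c ->
  (\esum_(k in [set: int]) (m k * c)%:E <=
   (\esum_(k in [set: int]) (m k)%:E) * c%:E)%E.
Proof.
move=> m0 c0; apply: ge_ereal_sup => _ [A [fA _] <-].
rewrite fsumEFin// -mulr_fsuml EFinM lee_wpmul2r ?lee_fin//.
by apply: esum_ge; exists A => //; rewrite fsumEFin.
Qed.

End summable_int.

Section c0_bisum.
Context {R : realType} {X : topologicalType}.
Local Notation c0 := (c0 R X).
Implicit Types u : int -> c0.

Definition c0_summable u := summable [set: int] (fun k => (c0norm (u k))%:E).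

Lemma c0_summableE u :
  c0_summable u = (\esum_(k in [set: int]) (c0norm (u k))%:E < +oo)%E :> Prop.
Proof.
rewrite /c0_summable /summable; under eq_esum do rewrite abse_EFin ger0_norm ?c0norm_ge0//.
by [].
Qed.

Lemma c0norm0 : c0norm (0 : c0) = 0.
Proof. by apply: ofR_inj; rewrite -c0_normE normr0 ofR0. Qed.

Lemma c0normN (f : c0) : c0norm (- f) = c0norm f.
Proof. by apply: ofR_inj; rewrite -!c0_normE normrN. Qed.

Lemma c0_esumE u : c0_summable u ->
  (fine (\esum_(k in [set: int]) (c0norm (u k))%:E))%:E =
  \esum_(k in [set: int]) (c0norm (u k))%:E.
Proof.
rewrite c0_summableE => uS; rewrite fineK// ge0_fin_numE//.
by apply: esum_ge0 => k _; rewrite lee_fin c0norm_ge0.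
Qed.

Lemma c0norm_sum (v : nat -> c0) (w : nat -> R) m n :
  (forall i, c0norm (v i) <= w i) ->
  c0norm (\sum_(m <= i < n) v i) <= \sum_(m <= i < n) w i.
Proof.
move=> vw; elim/big_ind2 : _ => [|a b c d ab cd|i _]; first by rewrite c0norm0.
  by rewrite (le_trans (ler_c0normD _ _))// lerD.
exact: vw.
Qed.

Lemma c0_bisum_cvg u : c0_summable u ->
  cvgn (series (fun i : nat => u (Posz i) + u (Negz i))).
Proof.
move=> uS.
pose w i := c0norm (u (Posz i)) + c0norm (u (Negz i)).
have w0 i : 0 <= w i by rewrite addr_ge0 ?c0norm_ge0.
have /cvg_ex[l wl] : cvgn (series w).
  apply: nondecreasing_is_cvgn.
    by apply/nondecreasing_seqP => n; rewrite /series/= big_nat_recr//= lerDl.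
  exists (fine (\esum_(k in [set: int]) (c0norm (u k))%:E)) => _ [n _ <-].
  rewrite -lee_fin c0_esumE//; apply: (sum_le_esum n) => k.
  exact: c0norm_ge0.
apply: c0_seq_cvg => e e0.
have e2 : 0 < e / 2 by rewrite divr_gt0.
have [N wN] := seq_dist_lt wl e2; exists N => n Nn.
rewrite -c0normN opprB sub_series_geq//.
apply: le_lt_trans (c0norm_sum _ _ (fun i => ler_c0normD _ _)) _.
rewrite -/(w _) -(sub_series_geq w Nn).
have := wN N (leqnn N); have := wN n Nn; rewrite !ltr_norml.
by move=> /andP[? ?] /andP[? ?]; lra.
Qed.

Lemma c0norm_bisum u : c0_summable u ->
  ((c0norm (bisum u))%:E <= \esum_(k in [set: int]) (c0norm (u k))%:E)%E.
Proof.
move=> uS; rewrite -c0_esumE// lee_fin; apply/ler_addgt0Pr => e e0.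
have e0' : 0 < ofR e by rewrite -ofR0 ofR_lt.
have [N /(_ N (leqnn N))] := seq_dist_lt (c0_bisum_cvg uS) e0'.
rewrite c0_normE ofR_lt -/(bisum u) => /ltW uN.
rewrite -(subrK (series (fun i : nat => u (Posz i) + u (Negz i)) N) (bisum u)).
rewrite (le_trans (ler_c0normD _ _))// addrC lerD//.
apply: le_trans (c0norm_sum _ _ (fun i => ler_c0normD _ _)) _.
rewrite -lee_fin c0_esumE//; apply: (sum_le_esum N) => k.
exact: c0norm_ge0.
Qed.

Lemma bisum1 u n : (forall k, k != n -> u k = 0) -> bisum u = u n.
Proof.
move=> u0; pose v (i : nat) := u (Posz i) + u (Negz i).
have [i [vi vj]] : exists i : nat, v i = u n /\ forall j, j != i -> v j = 0.
  case: n u0 => i u0; exists i; rewrite /v; split=> [|j ji].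
  - by rewrite (u0 (Negz i))// addr0.
  - by rewrite (u0 (Negz j))// addr0 u0.
  - by rewrite (u0 (Posz i))// add0r.
  - by rewrite (u0 (Posz j))// add0r u0.
apply: (@lim_near_cst _ _ _ _ _ (u n)); first exact: norm_hausdorff.
exists i.+1 => // N /= iN; rewrite /series/= (bigD1_seq i)/= ?iota_uniq//; last first.
  by rewrite mem_index_iota.
by rewrite -/(v _) vi big1 ?addr0// => j; exact: vj.
Qed.

End c0_bisum.

Section c0mul.
Context {R : realType} {X : topologicalType}.
Local Notation c0 := (c0 R X).
Implicit Types f g : c0.

Lemma c0mul_subproof f g : (fun x => f x * g x) \in @c0_pred R X.
Proof.
have [fc _] := c0_setP f; have [gc gv] := c0_setP g.
apply/mem_set; split=> [x|_ /gt0_ofR[e e0 ->]]; first exact: (cvgM (fc x) (gc x)).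
have M0 : 0 < c0norm f + 1 by rewrite ltr_wpDl ?c0norm_ge0.
have [K Kc Kg] := gv (ofR (e / (c0norm f + 1))) ltac:(by rewrite -ofR0 ofR_lt divr_gt0).
exists K => // x /Kg; rewrite -!modulusE !ofR_lt modulusM => gx.
rewrite (le_lt_trans (_ : _ <= modulus (g x) * (c0norm f + 1)))//; last by rewrite -ltr_pdivlMr.
by rewrite mulrC ler_wpM2l ?modulus_ge0// (le_trans (c0norm_ub _ _))// lerDl.
Qed.

Definition c0mul f g : c0 := C0 (c0mul_subproof f g).

Lemma c0norm_mul f g : c0norm (c0mul f g) <= c0norm f * c0norm g.
Proof.
apply: c0norm_le => [|x]; first by rewrite mulr_ge0 ?c0norm_ge0.
by rewrite modulusM ler_pM ?modulus_ge0 ?c0norm_ub.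
Qed.

End c0mul.

Record homeo (X : topologicalType) := Homeo {
  homeo_fun :> X -> X ;
  homeo_inv : X -> X ;
  homeoK : cancel homeo_fun homeo_inv ;
  homeo_invK : cancel homeo_inv homeo_fun ;
  homeo_continuous : continuous homeo_fun ;
  homeo_inv_continuous : continuous homeo_inv
}.

Definition homeo_sym (X : topologicalType) (s : homeo X) : homeo X :=
  Homeo (homeo_invK s) (homeoK s) (@homeo_inv_continuous _ s) (@homeo_continuous _ s).

Section c0push.
Context {R : realType} {X : topologicalType}.
Local Notation c0 := (c0 R X).
Implicit Types (f g : c0) (s : homeo X).

Lemma c0push_subproof s f : f \o homeo_inv s \in @c0_pred R X.
Proof.
have [fc fv] := c0_setP f; apply/mem_set; split=> [x|e /fv[K Kc Kf]].
  by apply: continuous_comp; [exact: homeo_inv_continuous|exact: fc].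
exists (s @` K) => [|x Kx /=].
  by apply: continuous_compact => //; apply: continuous_subspaceT; exact: homeo_continuous.
by apply: Kf => Ksx; apply: Kx; exists (homeo_inv s x) => //; rewrite homeo_invK.
Qed.

(* With s the homeomorphism of X induced by the automorphism,
   f \o s^-1 is the induced automorphism of C_0(X). *)
Definition c0push s f : c0 := C0 (c0push_subproof s f).

(* Integer iterates; [c0push (homeo_sym s)] is the inverse of [c0push s]. *)
Definition c0push_int s (n : int) : c0 -> c0 :=
  match n with
  | Posz k => iter k (c0push s)
  | Negz k => iter k.+1 (c0push (homeo_sym s))
  end.

Lemma c0norm_push s f : c0norm (c0push s f) <= c0norm f.
Proof. by apply: c0norm_le => [|x]; [exact: c0norm_ge0|exact: (c0norm_ub f)]. Qed.

Lemma c0norm_push_int s n f : c0norm (c0push_int s n f) <= c0norm f.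
Proof.
have H t k : c0norm (iter k (c0push t) f) <= c0norm f.
  by elim: k => //= k; apply: le_trans; exact: c0norm_push.
by case: n => k; exact: H.
Qed.

Lemma c0push_int0 s n : c0push_int s n 0 = 0.
Proof.
have H t k : iter k (c0push t) 0 = 0 :> c0.
  by elim: k => //= k ->; exact/val_inj/funext.
by case: n => k; exact: H.
Qed.

End c0push.

Section l1.
Context {R : realType} {X : topologicalType}.
Local Notation C := (Cplx R).
Local Notation c0 := (c0 R X).

Definition l1_set : set (int -> c0) := [set f | c0_summable f].

Definition l1_pred : {pred int -> c0} := mem l1_set.

(* [a : l1] is the formal sum of the (a n) delta^n. *)
Record l1 := L1 { l1_val :> int -> c0 ; _ : l1_val \in l1_pred }.
HB.instance Definition _ := [isSub for l1_val].
HB.instance Definition _ := [Choice of l1 by <:].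

Lemma l1P (f : l1) : c0_summable f.
Proof. by case: f => f /= /set_mem. Qed.

Lemma c0_summable_le (u : int -> c0) (M : \bar R) : (M < +oo)%E ->
  (\esum_(k in [set: int]) (c0norm (u k))%:E <= M)%E -> c0_summable u.
Proof. by move=> Moo uM; rewrite c0_summableE; exact: le_lt_trans uM Moo. Qed.

Lemma esum_c0Z (a : C) (u : int -> c0) :
  (\esum_(k in [set: int]) (c0norm (a *: u k))%:E <=
   (\esum_(k in [set: int]) (c0norm (u k))%:E) * (modulus a)%:E)%E.
Proof.
apply: le_trans (le_esumM _ (modulus_ge0 a)); last by move=> k; exact: c0norm_ge0.
by apply: le_esum => k _; rewrite lee_fin c0normZ mulrC.
Qed.

Lemma esum_c0D (u v : int -> c0) :
  (\esum_(k in [set: int]) (c0norm (u k + v k))%:E <=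
   \esum_(k in [set: int]) (c0norm (u k))%:E +
   \esum_(k in [set: int]) (c0norm (v k))%:E)%E.
Proof.
have c0norm_lee (w : int -> c0) k : (0 <= (c0norm (w k))%:E)%E.
  by rewrite lee_fin c0norm_ge0.
by rewrite -esumD//; apply: le_esum => k _; rewrite -EFinD lee_fin ler_c0normD.
Qed.

Lemma l1_submod_closed : submod_closed l1_pred.
Proof.
split=> [|a f g /set_mem fS /set_mem gS]; apply/mem_set.
  rewrite /l1_set/= c0_summableE esum1// => k _.
  by rewrite c0norm0.
have := esum_c0D (a \*: f) g; apply: c0_summable_le.
rewrite lte_add_pinfty//; last by rewrite -c0_summableE.
apply: le_lt_trans (esum_c0Z _ _) _.
by rewrite -c0_esumE// -EFinM ltry.
Qed.

HB.instance Definition _ := GRing.isSubmodClosed.Build _ _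
  l1_pred l1_submod_closed.
HB.instance Definition _ := [SubChoice_isSubLmodule of l1 by <:].

Definition l1norm (f : l1) : R :=
  fine (\esum_(n in [set: int]) (c0norm (f n))%:E).

Lemma l1normE (f : l1) :
  (l1norm f)%:E = \esum_(n in [set: int]) (c0norm (f n))%:E.
Proof. exact/c0_esumE/l1P. Qed.

Lemma l1norm_ge0 (f : l1) : 0 <= l1norm f.
Proof.
by rewrite -lee_fin l1normE esum_ge0// => k _; rewrite lee_fin c0norm_ge0.
Qed.

Lemma c0norm_l1 (f : l1) n : c0norm (f n) <= l1norm f.
Proof.
rewrite -lee_fin l1normE; apply: esum_ge; exists [set n] => //.
by rewrite fsbig_set1.
Qed.

Let l1_ler_normD (f g : l1) : ofR (l1norm (f + g)) <= ofR (l1norm f) + ofR (l1norm g).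
Proof. by rewrite -ofRD ofR_le -lee_fin EFinD !l1normE esum_c0D. Qed.

Let l1_normrZ (a : C) (f : l1) : ofR (l1norm (a *: f)) = `|a| * ofR (l1norm f).
Proof.
rewrite -modulusE -ofRM; congr ofR.
have le b g : l1norm (b *: g) <= modulus b * l1norm g.
  by rewrite -lee_fin mulrC EFinM !l1normE; exact: esum_c0Z.
apply/eqP; rewrite eq_le le/=; have [->|a0] := eqVneq a 0.
  by rewrite modulus0 mul0r l1norm_ge0.
have ma : 0 < modulus a.
  rewrite lt_neqAle modulus_ge0 andbT eq_sym.
  by apply: contra a0 => /eqP/modulus0_eq->.
by rewrite mulrC -ler_pdivlMr// mulrC -modulusV -{1}[f](scalerK a0) le.
Qed.

Let l1_normr0_eq0 (f : l1) : ofR (l1norm f) = 0 -> f = 0.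
Proof.
move=> /ofR_inj f0; apply/val_inj/funext => n; apply: c0norm0_eq.
by apply/eqP; rewrite eq_le c0norm_ge0 andbT -f0 c0norm_l1.
Qed.

HB.instance Definition _ := @Lmodule_isNormed.Build C l1 (fun f => ofR (l1norm f))
  l1_ler_normD l1_normrZ l1_normr0_eq0.

Lemma l1_delta_subproof (f : c0) (n : int) :
  (fun m => if m == n then f else 0) \in l1_pred.
Proof.
apply/mem_set; rewrite /l1_set/= c0_summableE.
have d0 k : (0 <= (c0norm (if k == n then f else 0))%:E)%E.
  by rewrite lee_fin c0norm_ge0.
rewrite (esumID [set n]) => [|k _]; last exact: d0.
rewrite (@setTI int) esum_set1// [X in (_ + X)%E]esum1 ?adde0 ?ltry//.
by move=> k [_ /eqP/negbTE ->]; rewrite c0norm0.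
Qed.

Definition l1_delta (f : c0) (n : int) : l1 := L1 (l1_delta_subproof f n).

Variable s : homeo X.

(* Twisted convolution, as a series in the norm of C_0(X). *)
Definition l1_conv (a b : l1) (n : int) : c0 :=
  bisum (fun k => c0mul (a k) (c0push_int s k (b (n - k)))).

Lemma c0norm_convE (a b : l1) n k :
  c0norm (c0mul (a k) (c0push_int s k (b (n - k)))) <= c0norm (a k) * c0norm (b (n - k)).
Proof.
rewrite (le_trans (c0norm_mul _ _))// ler_wpM2l ?c0norm_ge0//.
exact: c0norm_push_int.
Qed.

Lemma l1_conv_summable (a b : l1) n :
  c0_summable (fun k => c0mul (a k) (c0push_int s k (b (n - k)))).
Proof.
apply: (@c0_summable_le _ ((l1norm a)%:E * (l1norm b)%:E)); first by rewrite -EFinM ltry.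
rewrite (l1normE a).
apply: le_trans (le_esumM _ (l1norm_ge0 b)) => [|k]; last exact: c0norm_ge0.
apply: le_esum => k _; rewrite lee_fin (le_trans (c0norm_convE _ _ _ _))//.
by rewrite ler_wpM2l ?c0norm_ge0 ?c0norm_l1.
Qed.

Lemma l1_conv_norm (a b : l1) :
  (\esum_(n in [set: int]) (c0norm (l1_conv a b n))%:E <=
   (l1norm a * l1norm b)%:E)%E.
Proof.
apply: (@le_trans _ _ (\esum_(n in [set: int]) \esum_(k in [set: int])
    (c0norm (a k) * c0norm (b (n - k)))%:E)).
  apply: le_esum => n _; apply: le_trans (c0norm_bisum (l1_conv_summable a b n)) _.
  by apply: le_esum => k _; rewrite lee_fin c0norm_convE.
rewrite esum_swap; last first.
  by move=> *; rewrite lee_fin mulr_ge0 ?c0norm_ge0.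
rewrite EFinM (l1normE a).
apply: le_trans (le_esumM _ (l1norm_ge0 b)) => [|k]; last exact: c0norm_ge0.
apply: le_esum => k _; rewrite EFinM [leRHS]muleC (l1normE b).
under eq_esum do rewrite mulrC.
apply: le_trans (le_esumM _ (c0norm_ge0 (a k))) _ => [n|]; first exact: c0norm_ge0.
rewrite (reindex_esum setT setT (fun n => n - k) (fun n => (c0norm (b n))%:E))//.
split=> [//|i j _ _ /addIr//|i _]; by exists (i + k) => //; rewrite addrK.
Qed.

Lemma l1_mul_subproof (a b : l1) : l1_conv a b \in l1_pred.
Proof. by apply/mem_set; apply: c0_summable_le (l1_conv_norm a b); rewrite ltry. Qed.

Definition l1_mul (a b : l1) : l1 := L1 (l1_mul_subproof a b).

Lemma l1_mul_delta (f g : c0) (n m : int) :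
  l1_mul (l1_delta f n) (l1_delta g m) =
  l1_delta (c0mul f (c0push_int s n g)) (n + m).
Proof.
apply/val_inj/funext => p /=; rewrite /l1_conv (@bisum1 _ _ _ n) => [|k /negbTE kn].
  rewrite /= eqxx subr_eq [m + n]addrC; case: eqP => // _.
  by rewrite c0push_int0; apply/val_inj/funext => x /=; exact: mulr0.
by rewrite /= kn; apply/val_inj/funext => x /=; exact: mul0r.
Qed.

End l1.
Arguments l1 : clear implicits.

(* Automorphisms of a C*-algebra preserve the involution. *)
Record starAut (R : realType) (A : commCStarAlgType R) := StarAut {
  aut :> A -> A ;
  aut_inv : A -> A ;
  autK : cancel aut aut_inv ;
  aut_invK : cancel aut_inv aut ;
  autP : forall (c : Cplx R) (a b : A), aut (c *: a + b) = c *: aut a + aut b ;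
  autM : {morph aut : a b / amul a b} ;
  aut_star : {morph aut : a / astar a}
}.

Section spectrum_homeo.
Context {R : realType} {A : commCStarAlgType R}.
Implicit Types (sigma : starAut A) (mu : spectrum A).

Lemma spectrum_inj (mu nu : spectrum A) : mu =1 nu -> mu = nu.
Proof.
case: mu nu => [f fP] [g gP] /= /funext fg; case: _ / fg in gP *.
by congr Spectrum; exact: Prop_irrelevance.
Qed.

Lemma aut_inv_linear sigma (c : Cplx R) (a b : A) :
  aut_inv sigma (c *: a + b) = c *: aut_inv sigma a + aut_inv sigma b.
Proof. by apply: (can_inj (autK sigma)); rewrite autP !aut_invK. Qed.

Lemma aut_invM sigma : {morph aut_inv sigma : a b / amul a b}.
Proof.
by move=> a b; apply: (can_inj (autK sigma)); rewrite autM !aut_invK.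
Qed.

Lemma comp_aut_character sigma mu : is_character (@amul R A) (mu \o sigma).
Proof.
have [muL muM [a mua]] := char_funP mu; split=> [c u v|u v|].
- by rewrite /= autP muL.
- by rewrite /= autM muM.
- by exists (aut_inv sigma a); rewrite /= aut_invK.
Qed.

Lemma comp_aut_inv_character sigma mu :
  is_character (@amul R A) (mu \o aut_inv sigma).
Proof.
have [muL muM [a mua]] := char_funP mu; split=> [c u v|u v|].
- by rewrite /= aut_inv_linear muL.
- by rewrite /= aut_invM muM.
- by exists (sigma a); rewrite /= autK.
Qed.

Definition spectrum_push sigma mu : spectrum A :=
  Spectrum (comp_aut_inv_character sigma mu).
Definition spectrum_pull sigma mu : spectrum A :=
  Spectrum (comp_aut_character sigma mu).

Lemma spectrum_pushK sigma : cancel (spectrum_push sigma) (spectrum_pull sigma).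
Proof. by move=> mu; apply: spectrum_inj => a /=; rewrite autK. Qed.

Lemma spectrum_pullK sigma : cancel (spectrum_pull sigma) (spectrum_push sigma).
Proof. by move=> mu; apply: spectrum_inj => a /=; rewrite aut_invK. Qed.

Lemma gelfand_continuous (a : A) : continuous (fun mu : spectrum A => mu a).
Proof.
move=> mu; have := @initial_continuous _ _ (@char_fun R A : spectrum A -> {ptws A -> Cplx R}).
move=> /(_ mu) cf; have pc := @proj_continuous A (fun=> Cplx R) a (char_fun mu).
exact: (continuous_comp cf pc).
Qed.

Lemma spectrum_continuous (T : spectrum A -> spectrum A) :
  (forall a, continuous (fun mu => T mu a)) -> continuous T.
Proof.
move=> Tc; apply: (@continuous_comp_initial _ _ _
  (@char_fun R A : spectrum A -> {ptws A -> Cplx R}) T) => mu.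
apply: (pointwise_cvgP _ (fmap_filter _ (nbhs_filter mu))).2 => a.
exact: Tc.
Qed.

Lemma spectrum_push_continuous sigma : continuous (spectrum_push sigma).
Proof. by apply: spectrum_continuous => a; exact: gelfand_continuous. Qed.

Lemma spectrum_pull_continuous sigma : continuous (spectrum_pull sigma).
Proof. by apply: spectrum_continuous => a; exact: gelfand_continuous. Qed.

(* mu |-> mu \o sigma^-1 *)
Definition spectrum_homeo sigma : homeo (spectrum A) :=
  Homeo (spectrum_pushK sigma) (spectrum_pullK sigma)
    (@spectrum_push_continuous sigma) (@spectrum_pull_continuous sigma).

Definition Per1 sigma : set (spectrum A) := [set x | spectrum_homeo sigma x = x].

Definition l1_characters sigma : set (l1 R (spectrum A) -> Cplx R) :=
  [set mu | is_character (l1_mul (spectrum_homeo sigma)) mu].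

End spectrum_homeo.

Definition unit_circle (R : realType) : set (Cplx R) := [set z | `|z| = 1].
Arguments unit_circle : clear implicits.

(* Main.v *)
Require Import Defs.
From mathcomp Require Import all_boot all_order all_algebra.
From mathcomp Require Import all_classical all_reals all_analysis.
From mathcomp Require Import complex ring lra.
Import Order.TTheory GRing.Theory Num.Theory.
Import numFieldNormedType.Exports.
Local Open Scope classical_set_scope.
Local Open Scope ring_scope.

Set Implicit Arguments.
Unset Strict Implicit.
Unset Printing Implicit Defensive.

(**
The numbers mu(f delta^n) determine a character mu of the convolution algebra:
characters of a Banach algebra are contractive ([character_contractive]), and
finite sums of monomials f delta^n are dense ([l1_approx]); so two characters
that agree on monomials are equal ([l1_characters_eq]).

Existence. For |xi| = 1 the functional [l1_eval x xi], a |-> sum_n a_n(x) xi^n,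
is bounded and linear. When x is fixed by the homeomorphism, f(x) g(x) is the
value at x of the twisted product of f delta^n and g delta^m, so the functional
is multiplicative on monomials, and then everywhere by density
([l1_bilinear_eq0], [l1_evalM]).

Classification. Given mu, the functional f |-> mu(f delta^0) is a character of
C_0(X) ([l1_character_degree0]), hence the evaluation at some point x
([c0_character_eval]). With u(x) = 1 and z_n = mu(u delta^n), the commutativity
of C_0(X) gives mu(f delta^n) = f(x) z_n. Multiplying u delta by f delta^-1 then
gives f(y) = z_1 z_{-1} f(x), where y is the preimage of x under the
homeomorphism: two evaluations are proportional, so y = x. Hence n |-> z_n is a
homomorphism from Z to the nonzero complex numbers, z_n = z_1^n, and it is
bounded by the norm of u, which forces |z_1| = 1 ([l1_character_form]).

This requires C_0(X) to separate the points of X and to vanish nowhere. When X is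
the spectrum of A, the functions chi |-> chi(a) do both; they vanish at infinity
by the Banach-Alaoglu theorem ([compact_character_ge]).
*)

(** * Absolute values of complex numbers *)

Section modulus_extra.
Context {R : realType}.
Local Notation C := (Cplx R).

Lemma modulus_gt0 (z : C) : z != 0 -> 0 < modulus z.
Proof.
move=> z0; rewrite lt_neqAle modulus_ge0 andbT eq_sym.
by apply: contra z0 => /eqP/modulus0_eq->.
Qed.

Lemma modulus_le0 (z : C) : modulus z <= 0 -> z = 0.
Proof. by move=> z0; apply/modulus0_eq/eqP; rewrite eq_le z0 modulus_ge0. Qed.

Lemma modulus_ofR (r : R) : 0 <= r -> modulus (ofR r) = r.
Proof. by move=> r0; apply: ofR_inj; rewrite modulusE ger0_norm// -ofR0 ofR_le. Qed.

Lemma modulus1 : modulus (1 : C) = 1.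
Proof. by rewrite -[1]/(ofR 1) modulus_ofR. Qed.

Lemma modulus_conj (z : C) : modulus (z^*)%R = modulus z.
Proof. by apply: ofR_inj; rewrite !modulusE norm_conjC. Qed.

Lemma modulusX (z : C) (k : nat) : modulus (z ^+ k) = modulus z ^+ k.
Proof. by elim: k => [|k ih]; rewrite ?expr0 ?modulus1// !exprS modulusM ih. Qed.

End modulus_extra.

(** Bernoulli's inequality makes the powers of r > 1 unbounded. *)
Lemma power_bounded_le1 (R : realType) (r M : R) :
  (forall k : nat, r ^+ k <= M) -> r <= 1.
Proof.
move=> rM; rewrite leNgt; apply/negP => r1.
have d0 : 0 < r - 1 by rewrite subr_gt0.
have bern k : 1 + k%:R * (r - 1) <= r ^+ k.
  elim: k => [|k ih]; first by rewrite mul0r addr0.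
  rewrite exprS -natr1; have k0 : 0 <= (k%:R : R) by [].
  have : r * (1 + k%:R * (r - 1)) <= r * r ^+ k by rewrite ler_pM2l//; lra.
  have : 0 <= k%:R * ((r - 1) * (r - 1)) by rewrite mulr_ge0// mulr_ge0// ltW.
  by nra.
have M0 : 0 <= M by rewrite (le_trans _ (rM 0%N)).
have := archi_boundP (divr_ge0 M0 (ltW d0)); set k := Num.bound _.
rewrite ltr_pdivrMr// => Mk.
by have := bern k; have := rM k; lra.
Qed.

(** * Characters *)

Section character_linear.
Context {R : realType} {V : lmodType (Cplx R)} {mul : V -> V -> V}.
Context {phi : V -> Cplx R} (phiP : is_character mul phi).

Lemma character0 : phi 0 = 0.
Proof.
have [phiL _ _] := phiP; have := phiL 1 0 0.
by rewrite scaler0 addr0 mul1r => /eqP; rewrite addrC -subr_eq subrr => /eqP.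
Qed.

Lemma characterZ c v : phi (c *: v) = c * phi v.
Proof.
by have [phiL _ _] := phiP; rewrite -[c *: v]addr0 phiL character0 addr0.
Qed.

Lemma characterD u v : phi (u + v) = phi u + phi v.
Proof. by have [phiL _ _] := phiP; rewrite -[u]scale1r phiL mul1r scale1r. Qed.

Lemma characterB u v : phi (u - v) = phi u - phi v.
Proof. by rewrite -scaleN1r characterD characterZ mulN1r. Qed.

Lemma character_eq1 : exists e, phi e = 1.
Proof.
have [_ _ [v v0]] := phiP; exists ((phi v)^-1 *: v).
by rewrite characterZ mulVf.
Qed.

End character_linear.

Section real_norm.
Context {R : realType} {V : normedModType (Cplx R)}.
Implicit Types (u v : V).

(** The norm of V has complex values; comparisons with epsilons are easier in R,
    where the order is total. *)
Definition rnorm v : R := complex.Re `|v|.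

Lemma rnormE v : `|v| = ofR (rnorm v).
Proof. by apply/esym; apply: RRe_real; exact: normr_real. Qed.

Lemma rnorm_ge0 v : 0 <= rnorm v.
Proof. by rewrite -ofR_le -rnormE ofR0. Qed.

Lemma rnorm0 : rnorm 0 = 0.
Proof. by apply: ofR_inj; rewrite -rnormE normr0 ofR0. Qed.

Lemma rnorm0_eq v : rnorm v = 0 -> v = 0.
Proof. by move=> v0; apply/normr0_eq0; rewrite rnormE v0 ofR0. Qed.

Lemma ler_rnormD u v : rnorm (u + v) <= rnorm u + rnorm v.
Proof. by rewrite -ofR_le ofRD -!rnormE ler_normD. Qed.

Lemma rnormN v : rnorm (- v) = rnorm v.
Proof. by apply: ofR_inj; rewrite -!rnormE normrN. Qed.

Lemma rnormZ (c : Cplx R) v : rnorm (c *: v) = modulus c * rnorm v.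
Proof. by apply: ofR_inj; rewrite ofRM modulusE -!rnormE normrZ. Qed.

Lemma ler_rnorm_sum (t : nat -> V) (w : nat -> R) m n :
  (forall i, rnorm (t i) <= w i) ->
  rnorm (\sum_(m <= i < n) t i) <= \sum_(m <= i < n) w i.
Proof.
move=> tw; elim/big_ind2 : _ => [|a b c d ab cd|i _]; first by rewrite rnorm0.
  by rewrite (le_trans (ler_rnormD _ _))// lerD.
exact: tw.
Qed.

Lemma cvg_rnorm (s : nat -> V) (l : V) : s @ \oo --> l ->
  forall e : R, 0 < e ->
  exists N : nat, forall n : nat, (N <= n)%N -> rnorm (l - s n) < e.
Proof.
move=> sl e e0; have e0' : 0 < ofR e by rewrite -ofR0 ofR_lt.
have [N sN] := seq_dist_lt sl e0'; exists N => n /sN.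
by rewrite rnormE ofR_lt.
Qed.

Definition seq_complete := forall s : nat -> V,
  (forall e : R, 0 < e -> exists N : nat,
    forall n : nat, (N <= n)%N -> rnorm (s N - s n) < e) ->
  exists l : V, s @ \oo --> l.

Context (mul : V -> V -> V).
Hypothesis mulDr : right_distributive mul +%R.
Hypothesis rnormM : forall a b, rnorm (mul a b) <= rnorm a * rnorm b.
Hypothesis complete : seq_complete.

(** The Neumann series a + a a + a (a a) + ... solves b = a + a b. *)
Lemma quasi_inverse a : rnorm a < 1 -> exists b, b = a + mul a b.
Proof.
move=> a1; pose r := rnorm a; have r0 : 0 <= r := rnorm_ge0 a.
pose t i := iter i (mul a) a.
have tr i : rnorm (t i) <= r * r ^+ i.
  elim: i => [|i ih]; first by rewrite mulr1.
  by rewrite exprS (le_trans (rnormM _ _))// ler_wpM2l.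
have rcvg : (series (geometric r r) : R^nat) @ \oo --> r * (1 - r)^-1.
  by apply: cvg_geometric_series; rewrite ger0_norm.
have [l tl] : exists l : V, series t @ \oo --> l.
  apply: complete => e e0; have e2 : 0 < e / 2 by rewrite divr_gt0.
  have [N rN] := seq_dist_lt rcvg e2; exists N => n Nn.
  rewrite -rnormN opprB sub_series_geq//.
  apply: le_lt_trans (ler_rnorm_sum _ _ tr) _.
  rewrite -(sub_series_geq (geometric r r) Nn).
  have := rN N (leqnn N); have := rN n Nn; rewrite !ltr_norml.
  by move=> /andP[? ?] /andP[? ?]; lra.
have mul0 : mul a 0 = 0 by apply: (addrI (mul a 0)); rewrite -mulDr !addr0.
have mulB u v : mul a (u - v) = mul a u - mul a v.
  by apply: (addIr (mul a v)); rewrite -mulDr !subrK.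
have tS n : series t n.+1 = a + mul a (series t n).
  elim: n => [|n ih]; first by rewrite /series/= big_nat1 big_geq// mul0 addr0.
  by rewrite /series/= big_nat_recr//= [in RHS]big_nat_recr//= mulDr addrA -ih.
exists l; apply/eqP; rewrite -subr_eq0; apply/eqP/rnorm0_eq/eqP.
rewrite eq_le rnorm_ge0 andbT; apply/ler_addgt0Pr => e e0; rewrite add0r.
have e2 : 0 < e / 2 by rewrite divr_gt0.
have [N lN] := cvg_rnorm tl e2.
have -> : l - (a + mul a l) = (l - series t N.+1) - mul a (l - series t N).
  by rewrite tS mulB opprB !opprD !addrA addrNK.
rewrite (le_trans (ler_rnormD _ _))// rnormN [leRHS]splitr lerD//.
  exact/ltW/lN.
rewrite (le_trans (rnormM _ _))// (le_trans _ (ltW (lN N (leqnn N))))//.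
by rewrite ler_piMl ?rnorm_ge0// ltW.
Qed.

(** If phi a = 1 with a of norm less than 1, applying phi to b = a + a b gives
    phi b = 1 + phi b. The general case follows by scaling. *)
Lemma character_contractive phi : is_character mul phi ->
  forall a, modulus (phi a) <= rnorm a.
Proof.
move=> phiP a; have [_ phiM _] := phiP; rewrite leNgt; apply/negP => ap.
have phi0 : phi a != 0.
  by apply/eqP => p0; move: ap; rewrite p0 modulus0 ltNge rnorm_ge0.
have [|b bE] := @quasi_inverse ((phi a)^-1 *: a).
  by rewrite rnormZ modulusV mulrC ltr_pdivrMr ?mul1r// (le_lt_trans (rnorm_ge0 a)).
have : phi b = 1 + phi b.
  by rewrite {1}bE (characterD phiP) phiM (characterZ phiP) mulVf// mul1r.
by move/eqP; rewrite -subr_eq subrr eq_sym oner_eq0.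
Qed.

End real_norm.
Arguments seq_complete {R} V.

(** * Linearity of the operations on C_0(X) *)

Section c0_linear.
Context {R : realType} {X : topologicalType}.
Local Notation C := (Cplx R).
Local Notation c0 := (c0 R X).
Implicit Types (f g h : c0) (u v : int -> c0) (s : homeo X) (c : C).

Lemma bisum_linear c u v : c0_summable u -> c0_summable v ->
  bisum (fun k => c *: u k + v k) = c *: bisum u + bisum v.
Proof.
move=> /c0_bisum_cvg uS /c0_bisum_cvg vS; apply: cvg_lim.
  exact: norm_hausdorff.
rewrite [X in X @ _](_ : _ = (fun n =>
    c *: series (fun i : nat => u (Posz i) + u (Negz i)) n +
    series (fun i : nat => v (Posz i) + v (Negz i)) n)); last first.
  apply/funext => n; rewrite /series/= scaler_sumr -big_split/=.
  by apply: eq_bigr => i _; rewrite scalerDr addrACA.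
by apply: cvgD => //; apply: cvgZl_tmp.
Qed.

Lemma c0_eq f g : f =1 g -> f = g.
Proof. by move=> fg; exact/val_inj/funext. Qed.

Lemma c0_val0 x : (0 : c0) x = 0. Proof. by []. Qed.

Lemma c0_valD f g x : (f + g) x = f x + g x. Proof. by []. Qed.

Lemma c0_valZ c f x : (c *: f) x = c * f x. Proof. by []. Qed.

Lemma c0mulE f g x : c0mul f g x = f x * g x.
Proof. by []. Qed.

Lemma c0mul_linearl c f g h :
  c0mul (c *: f + g) h = c *: c0mul f h + c0mul g h.
Proof. by apply: c0_eq => x; rewrite c0_valD c0_valZ !c0mulE c0_valD c0_valZ; ring. Qed.

Lemma c0mul_linearr c f g h :
  c0mul f (c *: g + h) = c *: c0mul f g + c0mul f h.
Proof. by apply: c0_eq => x; rewrite c0_valD c0_valZ !c0mulE c0_valD c0_valZ; ring. Qed.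

Lemma c0push_int_linear s n c f g :
  c0push_int s n (c *: f + g) = c *: c0push_int s n f + c0push_int s n g.
Proof.
have H t k : iter k (c0push t) (c *: f + g) =
    c *: iter k (c0push t) f + iter k (c0push t) g.
  by elim: k => //= k ->; exact: c0_eq.
by case: n => k; exact: H.
Qed.

Lemma c0push_int_fixed s x : s x = x -> forall n f, c0push_int s n f x = f x.
Proof.
move=> sx.
have H t k f : homeo_inv t x = x -> iter k (c0push t) f x = f x.
  by move=> tx; elim: k => //= k ih; rewrite tx.
case=> k f; apply: H => //=.
by rewrite -[in LHS]sx homeoK.
Qed.

End c0_linear.

(** * The convolution algebra *)

Section l1_algebra.
Context {R : realType} {X : topologicalType}.
Local Notation C := (Cplx R).
Local Notation c0 := (c0 R X).
Local Notation l1 := (l1 R X).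
Implicit Types (f g : c0) (a b : l1) (c : C) (n m : int).

Lemma rnorm_l1 a : rnorm a = l1norm a. Proof. by []. Qed.

Lemma l1_eq a b : (forall n, a n = b n) -> a = b.
Proof. by move=> ab; exact/val_inj/funext. Qed.

Lemma l1_valD a b n : (a + b) n = a n + b n. Proof. by []. Qed.

Lemma l1_valZ c a n : (c *: a) n = c *: a n. Proof. by []. Qed.

Lemma l1_valB a b n : (a - b) n = a n - b n. Proof. by []. Qed.

Lemma l1_deltaE f n m : l1_delta f n m = if m == n then f else 0.
Proof. by []. Qed.

Lemma l1_delta_linear c f g n :
  l1_delta (c *: f + g) n = c *: l1_delta f n + l1_delta g n.
Proof.
apply: l1_eq => m; rewrite l1_valD l1_valZ !l1_deltaE.
by case: eqP => // _; rewrite scaler0 addr0.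
Qed.

Lemma l1norm_delta f n : l1norm (l1_delta f n) = c0norm f.
Proof.
apply: EFin_inj; rewrite l1normE.
have d0 k : (0 <= (c0norm (l1_delta f n k))%:E)%E by rewrite lee_fin c0norm_ge0.
rewrite (esumID [set n]) => [|k _]; last exact: d0.
rewrite (@setTI int) esum_set1// [X in (_ + X)%E]esum1 ?adde0 ?l1_deltaE ?eqxx//.
by move=> k [_ /eqP/negbTE kn]; rewrite l1_deltaE kn c0norm0.
Qed.

Lemma sum_l1_delta a (t : seq int) n : uniq t ->
  (\sum_(k <- t) l1_delta (a k) k) n = if n \in t then a n else 0.
Proof.
elim: t => [|k t ih]/=; first by rewrite big_nil.
move=> /andP[kt ut]; rewrite big_cons l1_valD ih// l1_deltaE in_cons.
case: eqVneq => [->|]/=; first by rewrite (negbTE kt) addr0.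
by rewrite add0r.
Qed.

(** The sum of the norms is a supremum over finite sets A of indices; when A
    nearly reaches it, the coefficients outside A contribute little. *)
Lemma l1_approx a (e : R) : 0 < e ->
  exists t : seq int, l1norm (a - \sum_(k <- t) l1_delta (a k) k) < e.
Proof.
move=> e0; pose w n := (c0norm (a n))%:E.
have w0 n : (0 <= w n)%E by rewrite lee_fin c0norm_ge0.
have : ((l1norm a - e)%:E < \esum_(n in [set: int]) w n)%E.
  by rewrite -l1normE lte_fin ltrBlDr ltrDl.
move=> /ereal_sup_gt[_ [A [fA _] <-]]; rewrite fsbig_finite//= => aA.
pose t : seq int := finmap.enum_fset (fset_set A); exists t.
have tA n : (n \in t) = (n \in A) by rewrite /t in_fset_set.
set r : l1 := a - _.
have ut : uniq t by exact: finmap.fset_uniq.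
have rE n : r n = if n \in t then 0 else a n.
  by rewrite l1_valB sum_l1_delta//; case: ifP; rewrite ?subrr ?subr0.
clearbody r.
have : (l1norm a)%:E = (\sum_(n <- t) w n + (l1norm r)%:E)%E.
  have pos (u : int -> c0) n : (0 <= (c0norm (u n))%:E)%E by rewrite lee_fin c0norm_ge0.
  rewrite !l1normE (esumID A) => [|n _]; last exact: pos.
  rewrite (@setTI int) esum_fset// fsbig_finite//=.
  congr (_ + _)%E; rewrite [RHS](esumID A) => [|n _]; last exact: pos.
  rewrite [X in (X + _)%E]esum1 ?add0e => [|n [_ An]]; last first.
    by rewrite rE tA mem_set// c0norm0.
  apply: eq_esum => n [_ An]; rewrite rE tA.
  by rewrite memNset.
have tE : (\sum_(n <- t) w n)%E = (\sum_(n <- t) c0norm (a n))%:E.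
  by rewrite -sumEFin.
move: aA; rewrite -/t tE -EFinD lte_fin => aA [aE].
by rewrite aE in aA; lra.
Qed.

(** A Cauchy sequence converges in each degree. Its distance to the degreewise
    limit h is estimated on finite sets of degrees, over which one may pass to
    the limit in the Cauchy condition. *)
Lemma l1_complete : seq_complete l1.
Proof.
move=> s sC.
have /choice[h hE] : forall k : int, exists h : c0, (fun i : nat => s i k) @ \oo --> h.
  move=> k; apply/cvg_ex/c0_seq_cvg => e e0; have [N sN] := sC e e0.
  by exists N => n /sN; apply: le_lt_trans; exact: (c0norm_l1 (s N - s n)).
have hsum (t : seq int) (d : R) : 0 < d -> exists M : nat,
    forall m : nat, (M <= m)%N -> \sum_(k <- t) c0norm (h k - s m k) < d.
  elim: t d => [|k t ih] d d0; first by exists 0%N => m _; rewrite big_nil.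
  have d2 : 0 < d / 2 by rewrite divr_gt0.
  have [M tM] := ih _ d2; have [N kN] := cvg_rnorm (hE k) d2.
  exists (maxn M N) => m; rewrite geq_max => /andP[/tM tm /kN km].
  by rewrite big_cons [ltRHS]splitr ltrD.
have tail (e : R) : 0 < e -> exists N : nat, forall n : nat, (N <= n)%N ->
    (\esum_(k in [set: int]) (c0norm (h k - s n k))%:E <= e%:E)%E.
  move=> e0; have e2 : 0 < e / 2 by rewrite divr_gt0.
  have [N sN] := sC _ e2; exists N => n Nn.
  apply: ge_ereal_sup => _ [A [fA _] <-]; rewrite fsbig_finite//= sumEFin lee_fin.
  set t : seq int := finmap.enum_fset (fset_set A); apply/ler_addgt0Pr => d d0.
  have [M tM] := hsum t d d0; pose m := maxn M N.
  have smn : l1norm (s m - s n) <= e.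
    have -> : s m - s n = (s N - s n) - (s N - s m).
      by rewrite opprB [RHS]addrC subrKA.
    have := ler_rnormD (s N - s n) (- (s N - s m)); rewrite rnormN.
    have := sN n Nn; have := sN m (leq_maxr _ _).
    by rewrite -!rnorm_l1; lra.
  apply: (@le_trans _ _ (\sum_(k <- t) (c0norm ((s m - s n) k) + c0norm (h k - s m k)))).
    apply: ler_sum => k _; have := ler_c0normD (s m k - s n k) (h k - s m k).
    by rewrite [X in c0norm X <= _]addrC subrKA.
  rewrite big_split/= lerD//; last by rewrite ltW// tM// leq_maxl.
  apply: le_trans smn; rewrite -lee_fin l1normE -sumEFin; apply: esum_ge.
  by exists A => //; rewrite fsbig_finite.
(* h is summable, as it differs from the summable s N by a summable family. *)
have [N sN] := tail 1 ltr01.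
have dP : (fun k => h k - s N k) \in @l1_pred R X.
  apply/mem_set; apply: (c0_summable_le _ (sN N (leqnn N))); exact: ltry.
pose l : l1 := L1 dP + s N.
have lE k : l k = h k by rewrite l1_valD/= subrK.
exists l; apply/cvgrPdist_le => _ /gt0_ofR[e e0 ->].
have [M sM] := tail e e0; exists M => // n /sM.
rewrite rnormE ofR_le rnorm_l1 -lee_fin l1normE; apply: le_trans.
by apply: le_esum => k _; rewrite l1_valB lE.
Qed.

Variable s : homeo X.

Lemma l1_mul_linearl c a a' b :
  l1_mul s (c *: a + a') b = c *: l1_mul s a b + l1_mul s a' b.
Proof.
apply: l1_eq => n; rewrite l1_valD l1_valZ /= /l1_conv.
rewrite -bisum_linear; [|exact: l1_conv_summable..].
by congr bisum; apply/funext => k; rewrite -c0mul_linearl.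
Qed.

Lemma l1_mul_linearr c a b b' :
  l1_mul s a (c *: b + b') = c *: l1_mul s a b + l1_mul s a b'.
Proof.
apply: l1_eq => n; rewrite l1_valD l1_valZ /= /l1_conv.
rewrite -bisum_linear; [|exact: l1_conv_summable..].
congr bisum; apply/funext => k.
by rewrite l1_valD l1_valZ c0push_int_linear c0mul_linearr.
Qed.

Lemma l1_mulDr : right_distributive (l1_mul s : l1 -> l1 -> l1) +%R.
Proof. by move=> a b b'; rewrite -[b]scale1r l1_mul_linearr !scale1r. Qed.

Lemma l1norm_mul a b : l1norm (l1_mul s a b) <= l1norm a * l1norm b.
Proof. by rewrite -lee_fin l1normE; exact: l1_conv_norm. Qed.

(** phi a is within M e of phi(p) = 0 when p is a finite sum of monomials at
    distance e from a. *)
Lemma l1_functional_eq0 (phi : l1 -> C) (M : R) :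
  (forall c a b, phi (c *: a + b) = c * phi a + phi b) ->
  (forall a, modulus (phi a) <= M * l1norm a) ->
  (forall f n, phi (l1_delta f n) = 0) -> forall a, phi a = 0.
Proof.
move=> phiL phiM phi_delta a; have phi0 : phi 0 = 0.
  by apply: modulus_le0; rewrite (le_trans (phiM _))// -rnorm_l1 rnorm0 mulr0.
have phi_sum (t : seq int) : phi (\sum_(k <- t) l1_delta (a k) k) = 0.
  elim: t => [|k t ih]; first by rewrite big_nil.
  by rewrite big_cons -[l1_delta _ _]scale1r phiL phi_delta ih mulr0 addr0.
have M1 : 0 < `|M| + 1 by rewrite ltr_wpDl.
apply: modulus_le0; apply/ler_addgt0Pr => e e0; rewrite add0r.
have [|t] := @l1_approx a (e / (`|M| + 1)); first by rewrite divr_gt0.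
set p := \sum_(k <- t) _ => ap.
have -> : phi a = phi (a - p).
  by rewrite -[in LHS](subrK p a) -[a - p]scale1r phiL phi_sum addr0 mul1r scale1r.
rewrite (le_trans (phiM _))//.
rewrite (le_trans (_ : _ <= l1norm (a - p) * (`|M| + 1)))//.
  rewrite mulrC ler_wpM2l ?l1norm_ge0//.
  by rewrite (le_trans (ler_norm _))// lerDl.
by rewrite -ler_pdivlMr// ltW.
Qed.

(** Density is used in one variable at a time. *)
Lemma l1_bilinear_eq0 (B : l1 -> l1 -> C) (M : R) :
  (forall b c a a', B (c *: a + a') b = c * B a b + B a' b) ->
  (forall a c b b', B a (c *: b + b') = c * B a b + B a b') ->
  (forall a b, modulus (B a b) <= M * l1norm a * l1norm b) ->
  (forall f n g m, B (l1_delta f n) (l1_delta g m) = 0) ->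
  forall a b, B a b = 0.
Proof.
move=> Bl Br BM B0 a.
apply: (@l1_functional_eq0 (B a) (M * l1norm a)); [exact: Br|exact: BM|].
move=> g m; move: a.
apply: (@l1_functional_eq0 (B^~ (l1_delta g m)) (M * c0norm g)).
- exact: Bl.
- by move=> a; rewrite (le_trans (BM _ _))// l1norm_delta mulrAC.
- by move=> f n; exact: B0.
Qed.

Lemma l1_character_contractive (phi : l1 -> C) : is_character (l1_mul s) phi ->
  forall a, modulus (phi a) <= l1norm a.
Proof.
exact: (@character_contractive R l1 (l1_mul s) l1_mulDr l1norm_mul l1_complete).
Qed.

End l1_algebra.

(** * Characters of C_0(X) are evaluations *)

Section c0_character.
Context {R : realType} {X : topologicalType}.
Local Notation C := (Cplx R).
Local Notation c0 := (c0 R X).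
Implicit Types (f g h e : c0).

(** Domination transfers vanishing at infinity. *)
Lemma c0_le_set (f : c0) (h : X -> C) : continuous h ->
  (forall x, modulus (h x) <= modulus (f x)) -> h \in @c0_pred R X.
Proof.
move=> hc hf; have [_ fv] := c0_setP f.
apply/mem_set; split=> // e /fv[K Kc Kf]; exists K => // x /Kf.
by apply: le_lt_trans; rewrite -!modulusE ofR_le.
Qed.

Lemma c0conj_subproof f : (fun x => ((f x)^*)%R) \in @c0_pred R X.
Proof.
have [fc _] := c0_setP f.
apply: (@c0_le_set f) => [x|x]; last by rewrite modulus_conj.
apply/(@cvgrPdist_lt _ _ _ (nbhs x)) => e e0.
have /(@cvgrPdist_lt _ _ _ (nbhs x))/(_ _ e0) := fc x; apply: filterS => y.
by rewrite -rmorphB norm_conjC.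
Qed.

Definition c0conj f : c0 := C0 (c0conj_subproof f).

Definition c0_nonneg h := forall x, h x = ofR (modulus (h x)).

Lemma c0_div_subproof e h : c0_nonneg h ->
  (fun x => e x * (1 + h x)^-1) \in @c0_pred R X.
Proof.
move=> h0; have [ec _] := c0_setP e; have [hc _] := c0_setP h.
have hE x : 1 + h x = ofR (1 + modulus (h x)) by rewrite {1}h0 ofRD.
have h1 x : 1 <= 1 + modulus (h x) by rewrite lerDl modulus_ge0.
apply: (@c0_le_set e) => x.
  apply: (cvgM (ec x)); apply: (cvgV _ (cvgD (cvg_cst _) (hc x))).
  rewrite hE; apply: contraTneq (h1 x) => /(congr1 modulus).
  rewrite modulus0 modulus_ofR => [->|]; first by rewrite -ltNge ltr01.
  exact: le_trans (h1 x).
rewrite modulusM modulusV hE modulus_ofR ?(le_trans _ (h1 x))//.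
by rewrite ler_piMr ?modulus_ge0// invf_le1// (lt_le_trans _ (h1 x)).
Qed.

(** Take g = h / (1 + h) with h = |f|^2 / d^2: then f - f g = f / (1 + h), and
    r / (1 + r^2 / d^2) is at most d for every r >= 0. *)
Lemma c0_approx_factor f (d : R) : 0 < d ->
  exists g, c0norm (f - c0mul f g) <= d.
Proof.
move=> d0; pose t := (d ^+ 2)^-1; have t0 : 0 <= t by rewrite invr_ge0 exprn_ge0// ltW.
pose h : c0 := ofR t *: c0mul f (c0conj f).
have hE x : h x = ofR (t * modulus (f x) ^+ 2).
  by rewrite c0_valZ c0mulE /= -normCK -modulusE ofRM !expr2 ofRM.
have hm x : 0 <= t * modulus (f x) ^+ 2 by rewrite mulr_ge0// exprn_ge0// modulus_ge0.
have hp : c0_nonneg h by move=> x; rewrite hE modulus_ofR.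
exists (C0 (c0_div_subproof h hp)); apply: c0norm_le => [|x]; first exact: ltW.
have h1E : 1 + h x = ofR (1 + t * modulus (f x) ^+ 2) by rewrite hE ofRD.
have h1 : 0 < 1 + t * modulus (f x) ^+ 2 by rewrite ltr_pwDl.
have h1n : 1 + h x != 0.
  by rewrite h1E -ofR0; apply: contraTneq h1 => /ofR_inj ->; rewrite ltxx.
rewrite [X in modulus X](_ : _ = f x / (1 + h x)); last first.
  have fracE (F : fieldType) (p q : F) : 1 + q != 0 -> p - p * (q / (1 + q)) = p / (1 + q).
    by move=> q1; field.
  exact: fracE.
rewrite modulusM modulusV h1E modulus_ofR ?(ltW h1)// ler_pdivrMr//.
have dt : d * t = d^-1 by rewrite /t expr2 invfM mulrA divff ?gt_eqF// mul1r.
rewrite mulrDr mulr1 mulrA dt.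
have r0 := modulus_ge0 (f x); set r := modulus (f x) in r0 *.
have dV0 : 0 < d^-1 by rewrite invr_gt0.
have rr : 0 <= d^-1 * r ^+ 2 by rewrite mulr_ge0 ?exprn_ge0// ltW.
have [rd|dr] := leP r d; first by rewrite (le_trans rd)// lerDl.
rewrite (le_trans (_ : r <= d^-1 * r ^+ 2))//; last by rewrite lerDr ltW.
by rewrite mulrC ler_pdivlMr// expr2 ler_wpM2l// ltW.
Qed.

Context (phi : c0 -> C) (phiP : is_character c0mul phi).

Lemma c0_character_contractive f : modulus (phi f) <= c0norm f.
Proof.
apply: (@character_contractive R c0 c0mul) phiP f.
- by move=> f g h; apply: c0_eq => x; rewrite c0mulE /= mulrDr.
- exact: c0norm_mul.
- by move=> s sC; apply/cvg_ex; exact: c0_seq_cvg.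
Qed.

(** Let phi e = 1. If the kernel of phi vanishes at x, then g - phi(g) e does, so
    evaluation at x is e(x) phi; both being multiplicative, e(x) = 1. *)
Lemma c0_character_eval_at x (x0 : exists f, f x != 0) :
  (forall f, phi f = f x) \/ (exists f, phi f = 0 /\ f x != 0).
Proof.
have [|kerx] := pselect (exists f, phi f = 0 /\ f x != 0); [by right|left].
have [_ phiM _] := phiP; have [e e1] := character_eq1 phiP.
have fE f : f x = phi f * e x.
  apply/eqP; rewrite -subr_eq0; apply/negP => fx; apply: kerx.
  exists (f - phi f *: e); split.
    by rewrite (characterB phiP) (characterZ phiP) e1 mulr1 subrr.
  by apply/negP => fx0; exact: fx.
have [f0 f0x] := x0.
have ex0 : e x != 0 by apply: contra_neq f0x => ex0; rewrite fE ex0 mulr0.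
have ex1 : e x = 1.
  by apply: (mulIf ex0); rewrite -[LHS]/(c0mul e e x) fE phiM e1 !mul1r.
by move=> f; rewrite fE ex1 mulr1.
Qed.

(** The kernel is an ideal, so it contains the nonnegative functions t |f|^2 with
    f in the kernel and t >= 0, and at each point some of these are as large as
    desired; by compactness a finite sum of them is large on all of K. *)
Lemma c0_character_large (K : set X) (M : R) : 0 <= M -> compact K ->
  (forall x, exists f, phi f = 0 /\ f x != 0) ->
  exists h, [/\ phi h = 0, c0_nonneg h & forall x, K x -> M < modulus (h x)].
Proof.
move=> M0 Kc ker; have [_ phiM _] := phiP; apply: contrapT => nh.
pose D h := phi h = 0 /\ c0_nonneg h.
pose Z h := [set x | K x /\ modulus (h x) <= M].
(* If every Z h is nonempty, they form a filter base, by nonnegativity. A cluster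
   point x in K then satisfies h x <= M for every h in D, which is absurd for a
   multiple h of |f|^2 with f x != 0. *)
have D0 : D 0.
  by split; [exact: character0 phiP|move=> x; rewrite c0_val0 modulus0].
have F : ProperFilter (filter_from D Z).
  apply: filter_from_proper; first apply: filter_from_filter.
  - by exists 0.
  - move=> f g [f0 fp] [g0 gp].
    have fgE x : modulus ((f + g) x) = modulus (f x) + modulus (g x).
      rewrite c0_valD {1}fp {1}gp -ofRD modulus_ofR//.
      by rewrite addr_ge0 ?modulus_ge0.
    exists (f + g).
      split; first by rewrite (characterD phiP) f0 g0 addr0.
      by move=> x; rewrite fgE ofRD -fp -gp.
    move=> x [Kx]; rewrite fgE => fg; split; split=> //.
      by apply: le_trans fg; rewrite lerDl modulus_ge0.
    by apply: le_trans fg; rewrite lerDr modulus_ge0.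
  - move=> h [h0 hp]; apply: contrapT => Zh; apply: nh; exists h; split=> // x Kx.
    by rewrite ltNge; apply/negP => hx; apply: Zh; exists x.
have FK : filter_from D Z K by exists 0 => // x [].
have [x [Kx]] := Kc _ F FK; rewrite clusterE => xF.
have hM h : D h -> modulus (h x) <= M.
  move=> Dh; have [hc _] := c0_setP h.
  have hcl : closed ((modulus \o h) @^-1` [set r | r <= M]).
    apply: preimage_closed; last exact: closed_le.
    by move=> y _; apply: continuous_comp; [exact: hc|exact: modulus_continuous].
  apply: (hcl x); apply: xF; exists h => // y; exact: proj2.
have [f [f0 fx]] := ker x.
have mfx := modulus_gt0 fx.
pose t := (M + 1) / (modulus (f x)) ^+ 2.
have t0 : 0 <= t by rewrite divr_ge0 ?exprn_ge0 ?addr_ge0// ltW.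
have ffE y : c0mul f (c0conj f) y = ofR (modulus (f y) ^+ 2).
  by rewrite c0mulE /= -normCK -modulusE expr2 ofRM.
have hE y : (ofR t *: c0mul f (c0conj f)) y = ofR (t * modulus (f y) ^+ 2).
  by rewrite c0_valZ ffE -ofRM.
have /hM : D (ofR t *: c0mul f (c0conj f)).
  split; first by rewrite (characterZ phiP) phiM f0 mul0r mulr0.
  by move=> y; rewrite hE modulus_ofR// mulr_ge0// exprn_ge0// modulus_ge0.
rewrite hE modulus_ofR; last by rewrite mulr_ge0// exprn_ge0// modulus_ge0.
by rewrite divfK ?expf_neq0 ?gt_eqF// gerDl ler10.
Qed.

(** Let phi e = 1 and, in case phi is not an evaluation, take h in the kernel,
    nonnegative and large where e is not small. Then g = e / (1 + h) has norm at
    most 1/2, while e = g + h g gives phi g = 1. *)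
Lemma c0_character_eval : (forall x : X, exists f, f x != 0) ->
  exists x, forall f, phi f = f x.
Proof.
move=> nv; apply: contrapT => neval.
have ker x : exists f, phi f = 0 /\ f x != 0.
  by have [phix|//] := c0_character_eval_at (nv x); case: neval; exists x.
have [_ phiM _] := phiP; have [e e1] := character_eq1 phiP.
have [_ ev] := c0_setP e.
have [K Kc Ke] := ev (ofR 2^-1) ltac:(by rewrite -ofR0 ofR_lt invr_gt0).
have [|h [h0 hp hK]] := @c0_character_large K (2 * c0norm e) _ Kc ker.
  by rewrite mulr_ge0 ?c0norm_ge0.
pose g : c0 := C0 (c0_div_subproof e hp).
have hE x : 1 + h x = ofR (1 + modulus (h x)) by rewrite {1}hp ofRD.
have h1 x : 1 <= 1 + modulus (h x) by rewrite lerDl modulus_ge0.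
have h1n x : 0 <= 1 + modulus (h x) by exact: le_trans (h1 x).
have gM x : modulus (g x) * (1 + modulus (h x)) = modulus (e x).
  rewrite modulusM modulusV hE modulus_ofR// divfK// gt_eqF//.
  exact: lt_le_trans (h1 x).
have eE : e = g + c0mul h g.
  apply: c0_eq => x; rewrite c0_valD c0mulE -[X in X + _]mul1r -mulrDl.
  rewrite mulrC /= divfK//; apply/eqP => /(congr1 modulus).
  rewrite hE modulus0 modulus_ofR// => hx0; have := h1 x.
  by rewrite hx0 ler10.
have phig : phi g = 1.
  by have := congr1 phi eE; rewrite (characterD phiP) phiM h0 mul0r addr0 e1.
have : c0norm g <= 2^-1.
  apply: c0norm_le => // x.
  rewrite -(ler_pM2r (lt_le_trans ltr01 (h1 x))) gM.
  have [Kx|/Ke] := pselect (K x).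
    by have := hK x Kx; have := c0norm_ub e x; lra.
  by rewrite -modulusE ofR_lt; have := modulus_ge0 (h x); lra.
have := c0_character_contractive g; rewrite phig modulus1; lra.
Qed.

End c0_character.

(** * The Gelfand transform *)

Section Cplx_box.
Context {R : realType}.
Local Notation C := (Cplx R).

Definition Cplx_box (M : R) : set C :=
  [set z | `|complex.Re z| <= M /\ `|complex.Im z| <= M].

(** A square replaces the disc: it is the image of a product of compact
    intervals. *)
Lemma compact_Cplx_box M : compact (Cplx_box M).
Proof.
pose j (p : R * R) : C := (p.1 +i* p.2)%C.
have jc : continuous j.
  move=> p; apply/(@cvgrPdist_lt _ _ _ (nbhs p)) => _ /gt0_ofR[e e0 ->].
  have e2 : 0 < e / 2 by rewrite divr_gt0.
  near=> t; rewrite -modulusE ofR_lt (le_lt_trans (modulus_ReIm _))//.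
  have -> : complex.Re (j p - j t) = p.1 - t.1 by exact: (raddfB (@complex.Re R)).
  have -> : complex.Im (j p - j t) = p.2 - t.2 by exact: (raddfB (@complex.Im R)).
  rewrite [ltRHS]splitr ltrD//; near: t.
    by apply: (@cvgr_dist_lt R R _ _ _ (fun t : R * R => t.1) p.1) => //; exact: cvg_fst.
  by apply: (@cvgr_dist_lt R R _ _ _ (fun t : R * R => t.2) p.2) => //; exact: cvg_snd.
have -> : Cplx_box M = j @` (`[- M, M] `*` `[- M, M]).
  apply/seteqP; split=> [[a b] [/= aM bM]|_ [[a b] [/= aM bM] <-]].
    by exists (a, b) => //=; rewrite !in_itv/= -!ler_norml.
  by move: aM bM; rewrite /Cplx_box/= !in_itv/= -!ler_norml.
apply: continuous_compact; first exact: continuous_subspaceT.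
by apply: compact_setX; exact: segment_compact.
Unshelve. all: by end_near. Qed.

End Cplx_box.

Section gelfand.
Context {R : realType} {A : commCStarAlgType R}.
Local Notation C := (Cplx R).
Implicit Types (a b : A) (chi : spectrum A).

Lemma cstar_complete : seq_complete A.
Proof.
move=> s sC; apply/cvg_ex; apply: cauchy_cvg; apply: cauchy_exP => _ /gt0_ofR[e e0 ->].
have [N sN] := sC e e0; exists (s N); exists N => // n /= Nn.
by rewrite -ball_normE/= rnormE ofR_lt sN.
Qed.

Lemma character_le_norm chi a : modulus (chi a) <= rnorm a.
Proof.
apply: (character_contractive (mul := @amul R A)) (char_funP chi) a.
- by move=> u v w; rewrite amulC amulDl amulC [amul w _]amulC.
- by move=> u v; rewrite -ofR_le ofRM -!rnormE anormM.
- exact: cstar_complete.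
Qed.

(** The Banach-Alaoglu argument: characters are contractive, so by Tychonoff any
    filter of characters has a pointwise cluster point p : A -> C. The identities
    defining a character are closed conditions and pass to p, and the lower bound
    on [chi a] keeps p from being zero. *)
Lemma compact_character_ge a (e : R) : 0 < e ->
  compact [set chi : spectrum A | e <= modulus (chi a)].
Proof.
move=> e0 F FF FK; pose iota : spectrum A -> {ptws A -> C} := @char_fun R A.
have Bc : compact ([set f | forall b, Cplx_box (rnorm b) (f b)] : set {ptws A -> C}) :=
  @tychonoff A (fun=> C) (fun b => Cplx_box (rnorm b))
    (fun b => @compact_Cplx_box R (rnorm b)).
have FB : F (iota @^-1` [set f | forall b, Cplx_box (rnorm b) (f b)]).
  apply: filterS FK => chi _ b /=; have chib := character_le_norm chi b.
  by split; apply: le_trans chib; [exact: Re_modulus|exact: Im_modulus].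
have [p [_ pG]] := Bc (iota @ F) _ FB.
(* Closed conditions satisfied by the characters chi at hand hold for p. *)
have pclosed (T : topologicalType) (g : {ptws A -> C} -> T) (D : set T) :
    continuous g -> closed D ->
    (forall chi, e <= modulus (chi a) -> D (g (iota chi))) -> D (g p).
  move=> gc Dc gD; have gDc : closed (g @^-1` D).
    by apply: preimage_closed => // x _; exact: gc.
  have FD : F (iota @^-1` (g @^-1` D)) by apply: filterS FK => chi /gD.
  by rewrite clusterE in pG; exact: gDc (pG _ FD).
have evc b : continuous (fun f : {ptws A -> C} => f b).
  by move=> f; exact: (@proj_continuous A (fun=> C) b f).
have closed0 : closed [set 0 : C].
  by apply: accessible_closed_set1; apply: hausdorff_accessible; exact: norm_hausdorff.
have pa : e <= modulus (p a).
  apply: (pclosed R (fun f => modulus (f a)) [set r | e <= r]) => //.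
  by move=> f; apply: continuous_comp; [exact: evc|exact: modulus_continuous].
have pP : is_character (@amul R A) p.
  split=> [c u v|u v|].
  - apply/eqP; rewrite -subr_eq0; apply/eqP.
    apply: (pclosed C (fun f => f (c *: u + v) - (c * f u + f v)) [set 0]) => //.
      move=> f; exact: (cvgB (evc _ f) (cvgD (cvgZl_tmp (k := c) (evc u f)) (evc v f))).
    by move=> chi _; have [chiL _ _] := char_funP chi; rewrite /iota/= chiL subrr.
  - apply/eqP; rewrite -subr_eq0; apply/eqP.
    apply: (pclosed C (fun f => f (amul u v) - f u * f v) [set 0]) => //.
      by move=> f; exact: (cvgB (evc _ f) (cvgM (evc u f) (evc v f))).
    by move=> chi _; have [_ chiM _] := char_funP chi; rewrite /iota/= chiM subrr.
  - exists a; apply: contraTneq pa => ->.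
    by rewrite modulus0 -ltNge.
exists (Spectrum pP); split=> //.
move=> U V FU; case=> W [[/= W' W'o <-] Wp WV].
have : nbhs p W' by exact: open_nbhs_nbhs.
have : F (iota @^-1` (iota @` U)) by apply: filterS FU => chi Uchi; exists chi.
move=> /pG/[apply] -[_ [[chi Uchi <-] W'chi]].
by exists chi; split=> //; exact: WV.
Qed.

Lemma gelfand_subproof a :
  (fun chi : spectrum A => chi a) \in @c0_pred R (spectrum A).
Proof.
apply/mem_set; split=> [chi|_ /gt0_ofR[e e0 ->]]; first exact: gelfand_continuous.
exists [set chi : spectrum A | e <= modulus (chi a)].
  exact: compact_character_ge.
by move=> chi /negP; rewrite -ltNge -modulusE ofR_lt.
Qed.

Definition gelfand a : c0 R (spectrum A) := C0 (gelfand_subproof a).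

Lemma c0_spectrum_nonvanishing chi : exists f : c0 R (spectrum A), f chi != 0.
Proof. by have [_ _ [a chia]] := char_funP chi; exists (gelfand a). Qed.

Lemma c0_spectrum_separates chi chi' :
  (forall f : c0 R (spectrum A), f chi = f chi') -> chi = chi'.
Proof. by move=> fE; apply: spectrum_inj => a; exact: (fE (gelfand a)). Qed.

End gelfand.

(** * Characters given by a fixed point and a unit complex number *)

Section evaluation.
Context {R : realType} {X : topologicalType} (s : homeo X).
Local Notation C := (Cplx R).
Local Notation c0 := (c0 R X).
Local Notation l1 := (l1 R X).
Implicit Types (f g : c0) (a b : l1) (n m : int).

Context (x : X) (xi : C) (xi1 : unit_circle R xi).

(** Summing in [c0] before evaluating at x reduces convergence and norm bounds to
    those of series in C_0(X). *)
Definition l1_eval a : C :=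
  (bisum (fun n => xi ^ n *: a n) : c0) x.

Lemma modulus_circle n : modulus (xi ^ n) = 1.
Proof.
have m1 : modulus xi = 1 by apply: ofR_inj; rewrite modulusE.
case: n => k; first by rewrite -exprnP modulusX m1 expr1n.
by rewrite NegzE -exprnN modulusV modulusX m1 expr1n invr1.
Qed.

Lemma circle_neq0 : xi != 0.
Proof. by apply: contra_eq_neq xi1 => ->; rewrite normr0 eq_sym oner_eq0. Qed.

Lemma c0norm_circle a n : c0norm (xi ^ n *: a n) = c0norm (a n).
Proof. by rewrite c0normZ modulus_circle mul1r. Qed.

Lemma l1_eval_summable a : c0_summable (fun n => xi ^ n *: a n).
Proof.
apply: (@c0_summable_le _ _ _ (l1norm a)%:E); first exact: ltry.
by rewrite l1normE; apply: le_esum => n _; rewrite c0norm_circle.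
Qed.

Lemma l1_eval_linear c a b : l1_eval (c *: a + b) = c * l1_eval a + l1_eval b.
Proof.
rewrite /l1_eval -c0_valZ -c0_valD -bisum_linear; [|exact: l1_eval_summable..].
congr ((bisum _ : c0) x); apply/funext => n.
by rewrite l1_valD l1_valZ scalerDr !scalerA mulrC.
Qed.

Lemma l1_eval_le a : modulus (l1_eval a) <= l1norm a.
Proof.
rewrite (le_trans (c0norm_ub _ x))// -lee_fin.
apply: le_trans (c0norm_bisum (l1_eval_summable a)) _; rewrite l1normE.
by apply: le_esum => n _; rewrite c0norm_circle.
Qed.

Lemma l1_eval_delta f n : l1_eval (l1_delta f n) = f x * xi ^ n.
Proof.
rewrite /l1_eval (@bisum1 _ _ _ n) => [|k /negbTE kn].
  by rewrite l1_deltaE eqxx c0_valZ mulrC.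
by rewrite l1_deltaE kn scaler0.
Qed.

Hypothesis sx : s x = x.

(** Both sides are bounded and bilinear, hence it suffices to compare them on the
    [l1_delta f n], where the twist disappears because x is fixed. *)
Lemma l1_evalM a b : l1_eval (l1_mul s a b) = l1_eval a * l1_eval b.
Proof.
apply/eqP; rewrite -subr_eq0; apply/eqP; move: a b.
apply: (@l1_bilinear_eq0 _ _ _ 2).
- by move=> b c a a'; rewrite l1_mul_linearl !l1_eval_linear mulrDl opprD addrACA mulrBr mulrA.
- by move=> a c b b'; rewrite l1_mul_linearr !l1_eval_linear mulrDr opprD addrACA mulrBr mulrCA.
- move=> a b; have := ler_modulusD (l1_eval (l1_mul s a b)) (- (l1_eval a * l1_eval b)).
  rewrite modulusN modulusM => /le_trans; apply.
  rewrite -mulrA mulr2n mulrDl mul1r lerD//.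
    exact: le_trans (l1_eval_le _) (l1norm_mul _ _ _).
  by rewrite ler_pM ?modulus_ge0// l1_eval_le.
- move=> f n g m; rewrite l1_mul_delta !l1_eval_delta c0mulE c0push_int_fixed//.
  by rewrite expfzDr ?circle_neq0//; ring.
Qed.

Lemma l1_eval_character : (exists f, f x != 0) -> is_character (l1_mul s) l1_eval.
Proof.
move=> [f fx]; split; [exact: l1_eval_linear|exact: l1_evalM|].
by exists (l1_delta f 0); rewrite l1_eval_delta expr0z mulr1.
Qed.

End evaluation.

(** * Every character has this form *)

Section classification.
Context {R : realType} {X : topologicalType} (s : homeo X).
Local Notation C := (Cplx R).
Local Notation c0 := (c0 R X).
Local Notation l1 := (l1 R X).
Implicit Types (f g : c0) (a b : l1) (n m : int).

Lemma l1_characters_eq (mu nu : l1 -> C) :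
  is_character (l1_mul s) mu -> is_character (l1_mul s) nu ->
  (forall n f, mu (l1_delta f n) = nu (l1_delta f n)) -> mu = nu.
Proof.
move=> muP nuP munu; apply/funext => a; apply/eqP; rewrite -subr_eq0; apply/eqP.
move: a; apply: (@l1_functional_eq0 _ _ _ 2).
- move=> c a b; rewrite (characterD muP) (characterD nuP) (characterZ muP).
  by rewrite (characterZ nuP); ring.
- move=> a; rewrite (le_trans (ler_modulusD _ _))// modulusN mulr2n mulrDl mul1r.
  by rewrite lerD// (l1_character_contractive muP, l1_character_contractive nuP).
- by move=> f n; rewrite munu subrr.
Qed.

Context (mu : l1 -> C) (muP : is_character (l1_mul s) mu).
Hypothesis nonvanishing : forall x : X, exists f, f x != 0.
Hypothesis separates : forall x y : X, (forall f, f x = f y) -> x = y.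

Let mu_delta_le f n : modulus (mu (l1_delta f n)) <= c0norm f.
Proof. by rewrite -(l1norm_delta f n) (l1_character_contractive muP). Qed.

Let mu_deltaM f n g m :
  mu (l1_delta f n) * mu (l1_delta g m) =
  mu (l1_delta (c0mul f (c0push_int s n g)) (n + m)).
Proof. by have [_ muM _] := muP; rewrite -muM l1_mul_delta. Qed.

(** Only nontriviality is at stake. If mu vanished in degree 0, then it would
    vanish on (g delta^0) (f delta^n) = f g delta^n for all f and g, hence on
    every f delta^n by approximate factorization, and mu would be zero. *)
Lemma l1_character_degree0 :
  is_character c0mul (fun f => mu (l1_delta f 0) : C).
Proof.
have [muL _ [a mua]] := muP; split=> [c f g|f g|].
- by rewrite l1_delta_linear muL.
- by rewrite mu_deltaM.
apply: contrapT => mu0; move: mua; apply/negP; rewrite negbK; apply/eqP.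
move: a; apply: (@l1_functional_eq0 _ _ _ 1) => // [a|f n].
  by rewrite mul1r (l1_character_contractive muP).
have mu00 g : mu (l1_delta g 0) = 0.
  by apply: contrapT => /eqP g0; apply: mu0; exists g.
apply: modulus_le0; apply/ler_addgt0Pr => d d0; rewrite add0r.
have [g fg] := c0_approx_factor f d0.
apply: le_trans fg; apply: le_trans (mu_delta_le _ n).
have -> : l1_delta (f - c0mul f g) n = l1_delta f n - l1_mul s (l1_delta g 0) (l1_delta f n).
  rewrite l1_mul_delta add0r; apply: l1_eq => m; rewrite l1_valB !l1_deltaE.
  case: eqP => _; last by rewrite subr0.
  by congr (_ - _); apply: c0_eq => x; rewrite !c0mulE mulrC.
have [_ muM _] := muP.
by rewrite (characterB muP) muM mu00 mul0r subr0.
Qed.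

(** x is the point evaluated in degree 0, and xi is the value of mu on u delta for
    any u with u x = 1. *)
Lemma l1_character_form : exists (x : X) (xi : C),
  [/\ s x = x, unit_circle R xi &
      forall n f, mu (l1_delta f n) = f x * xi ^ n].
Proof.
have [x phiE] := c0_character_eval l1_character_degree0 nonvanishing.
have [u ux] : exists u : c0, u x = 1.
  by have [f fx] := nonvanishing x; exists ((f x)^-1 *: f); rewrite c0_valZ mulVf.
pose z n := mu (l1_delta u n).
have muE n f : mu (l1_delta f n) = f x * z n.
  rewrite -phiE mu_deltaM add0r -[LHS]mul1r -ux -phiE mu_deltaM add0r.
  by congr (mu (l1_delta _ n)); apply: c0_eq => y; rewrite !c0mulE mulrC.
pose y := homeo_inv s x.
have fyE f : f y = z 1 * z (-1) * f x.
  have := mu_deltaM u 1 f (-1); rewrite !muE ux mul1r subrr.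
  have -> : z 0 = 1 by rewrite /z phiE.
  rewrite mulr1 c0mulE ux mul1r => pushE.
  by rewrite -[f y]/(c0push_int s 1 f x) -pushE mulrA mulrAC.
(* Evaluation at y is c times evaluation at x; testing on u and u^2, c = c^2. *)
have yx : y = x.
  apply: separates; have [f fy] := nonvanishing y.
  have c0 : z 1 * z (-1) != 0.
    by apply: contra_neq fy => c0; rewrite fyE c0 mul0r.
  suff c1 : z 1 * z (-1) = 1 by move=> g; rewrite fyE c1 mul1r.
  apply: (mulIf c0); rewrite mul1r; have := fyE (c0mul u u).
  by rewrite !c0mulE !fyE ux !mulr1.
have sx : s x = x by rewrite -{1}yx homeo_invK.
have zM n m : z (n + m) = z n * z m.
  have -> : z n * z m = _ := mu_deltaM u n u m.
  by rewrite [RHS]muE c0mulE c0push_int_fixed// ux !mul1r.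
have z0 : z 0 = 1 by rewrite /z phiE.
have z1 : z 1 != 0.
  apply/eqP => z10; have := zM 1 (-1); rewrite subrr z0 z10 mul0r => /eqP.
  by rewrite oner_eq0.
have zE n : z n = z 1 ^ n.
  elim/int_ind: n => [|n ih|n ih]; first by rewrite z0 expr0z.
    by rewrite intS zM ih expfzDr// expr1z.
  have nE : 1 + - n.+1%:Z = - n%:Z by rewrite intS opprD addrA subrr add0r.
  by apply: (mulfI z1); rewrite -zM -[X in _ = X * _]expr1z -expfzDr// nE ih.
(* Powers of z 1 of both signs are bounded by the norm of u. *)
have zle n : modulus (z n) <= c0norm u by exact: mu_delta_le.
exists x, (z 1); split=> //; last by move=> n f; rewrite muE zE.
have le1 : modulus (z 1) <= 1.
  by apply: (@power_bounded_le1 _ _ (c0norm u)) => k; rewrite -modulusX exprnP -zE.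
have ge1 : (modulus (z 1))^-1 <= 1.
  apply: (@power_bounded_le1 _ _ (c0norm u)) => k.
  by rewrite -modulusV -modulusX exprVn exprnN -zE.
have m1 : modulus (z 1) = 1.
  apply/eqP; rewrite eq_le le1/= -invf_le1//.
  exact: modulus_gt0.
by rewrite /unit_circle/= -modulusE m1.
Qed.

End classification.

Theorem mainTheorem8 (R : realType) (A : commCStarAlgType R) (sigma : starAut A) :
  [/\ forall (x : spectrum A) (xi : Cplx R),
        Per1 sigma x -> unit_circle R xi ->
        exists! mu : l1 R (spectrum A) -> Cplx R,
          l1_characters sigma mu /\
          forall (n : int) (f : c0 R (spectrum A)),
            mu (l1_delta f n) = f x * xi ^ n,
      forall mu : l1 R (spectrum A) -> Cplx R,
        l1_characters sigma mu ->
        exists! p : spectrum A * Cplx R,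
          [/\ Per1 sigma p.1, unit_circle R p.2
            & forall (n : int) (f : c0 R (spectrum A)),
                mu (l1_delta f n) = f p.1 * p.2 ^ n]
    & exists Phi : spectrum A * Cplx R -> (l1 R (spectrum A) -> Cplx R),
        (forall (x : spectrum A) (xi : Cplx R),
           Per1 sigma x -> unit_circle R xi ->
           forall (n : int) (f : c0 R (spectrum A)),
             Phi (x, xi) (l1_delta f n) = f x * xi ^ n) /\
        set_bij (Per1 sigma `*` unit_circle R) (l1_characters sigma) Phi].
Proof.
have nv := @c0_spectrum_nonvanishing R A.
have sep := @c0_spectrum_separates R A.
have evP x xi : Per1 sigma x -> unit_circle R xi ->
    l1_characters sigma (l1_eval x xi).
  by move=> sx xi1; exact: (l1_eval_character xi1 sx (nv x)).
have param_inj (x y : spectrum A) (xi eta : Cplx R) :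
    (forall (n : int) (f : c0 R (spectrum A)), f x * xi ^ n = f y * eta ^ n) ->
    (x, xi) = (y, eta).
  move=> E; have xy : x = y.
    by apply: sep => f; have := E 0 f; rewrite !expr0z !mulr1.
  have [f fy] := nv y; have := E 1 f.
  by rewrite !expr1z xy => /(mulfI fy) ->.
split.
- move=> x xi sx xi1; exists (l1_eval x xi); split.
    by split; [exact: evP|move=> n f; exact: l1_eval_delta].
  move=> nu [nuP nuE]; apply: (l1_characters_eq (evP _ _ sx xi1) nuP) => n f.
  by rewrite l1_eval_delta nuE.
- move=> mu muP; have [x [xi [sx xi1 muE]]] := l1_character_form muP nv sep.
  exists (x, xi); split=> // -[y eta] [/= _ _ muE'].
  by apply: param_inj => n f; rewrite -muE muE'.
- exists (fun p => l1_eval p.1 p.2); split=> [x xi _ _ n f|]; first exact: l1_eval_delta.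
  split=> [[x xi] [/= sx xi1]|[x xi] [y eta] _ _ /= ev|mu muP].
  + exact: evP.
  + by apply: param_inj => n f; rewrite -!l1_eval_delta ev.
  + have [x [xi [sx xi1 muE]]] := l1_character_form muP nv sep.
    exists (x, xi) => //=; apply: (l1_characters_eq (evP _ _ sx xi1) muP) => n f.
    by rewrite l1_eval_delta muE.
Qed.
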